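(* Let $d$ be a positive integer and let $\mathrm{Grid}_d$ be the infinite $d$-dimensional grid, that is, the graph on $\mathbb{Z}^d$ where two vertices are connected if they are at Euclidean distance $1$. Then $\rho(\mathrm{Grid}_d)=f(1)=(12+\sqrt{8})/17$.
   Context: Let $K_{\mathbb{N}}$ be the complete graph on the natural numbers $\mathbb{N}=\{1,2,\dots\}$, and $[n]=\{1,\dots,n\}$. For $S\subseteq\mathbb{N}$ the (upper) density is $\bar d(S)=\limsup_{n\to\infty}|S\cap[n]|/n$, and for a subgraph $H'\subseteq K_{\mathbb{N}}$ we set $\bar d(H')=\bar d(V(H'))$. For a countably infinite graph $H$ (vertex set of the same cardinality as $\mathbb{N}$), the Ramsey upper density $\rho(H)$ is the supremum of the values $\lambda$ for which, for every two-coloring of $E(K_{\mathbb{N}})$, there exists a monochromatic (not necessarily induced) subgraph $H'\subseteq K_{\mathbb{N}}$, isomorphic to $H$, with $\bar d(H')\geq\lambda$. Definition of $f:[0,+\infty]\to\mathbb{R}$. Let $\gamma\in(-1,1)$. For a continuous $g:[0,+\infty)\to\mathbb{R}$ let $\Gamma^+_\gamma(g,t)=\min\{x:\gamma x+g(x)\geq t\}$ and $\Gamma^-_\gamma(g,t)=\min\{x:\gamma x-g(x)\geq t\}$, the minimum of the empty set being $+\infty$. Let $h(\gamma)=\inf_g\limsup_{t\to\infty}\frac{\Gamma^+_\gamma(g,t)+\Gamma^-_\gamma(g,t)}{t}$, the infimum being over all 1-Lipschitz functions $g:[0,+\infty)\to\mathbb{R}$ with $g(0)=0$ (1-Lipschitz: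 $|g(x)-g(y)|\leq|x-y|$ for all $x,y$). For $\lambda\in(0,+\infty)$ set \[f(\lambda)=1-\frac{1}{\frac{2\lambda}{(1+\lambda)^2}h\left(\frac{\lambda-1}{\lambda+1}\right)+\frac{2\lambda}{1+\lambda}},\] and $f(0)=1$, $f(+\infty)=1/2$. *)

(* Defs.v *)
From mathcomp Require Import all_boot all_order all_algebra.
From mathcomp Require Import all_classical all_reals all_analysis.

Set Implicit Arguments.
Unset Strict Implicit.
Unset Printing Implicit Defensive.
Import Order.TTheory GRing.Theory Num.Theory.
Import numFieldNormedType.Exports.

Local Open Scope classical_set_scope.
Local Open Scope ring_scope.

Record graph (T : Type) := Graph {
  vertices : set T;
  adj : T -> T -> Prop;
  adj_vertices : forall x y, adj x y -> vertices x;
  adj_sym : forall x y, adj x y -> adj y x;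
  adj_irrefl : forall x, ~ adj x x }.

Definition subgraph (T : Type) (G K : graph T) : Prop :=
  vertices G `<=` vertices K /\ (forall x y, adj G x y -> adj K x y).

Definition isomorphic (T U : Type) (G : graph T) (H : graph U) : Prop :=
  exists2 phi : T -> U, set_bij (vertices G) (vertices H) phi &
    forall x y, vertices G x -> vertices G y ->
      (adj G x y <-> adj H (phi x) (phi y)).

(* The vertex set is {1, 2, ...}: the element 0 of [nat] is excluded. *)
Definition K_N : graph nat.
Proof.
by refine (@Graph nat [set n | 0 < n]%N
    (fun m n => [/\ (0 < m)%N, (0 < n)%N & m <> n]) _ _ _);
  [move=> m n [] | move=> m n [m0 n0 /nesym mn] | move=> n []].
Defined.

(* [c m n] is the colour of the edge {m, n}; the values of [c] off the edges of
   [K_N] are irrelevant. *)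
Definition coloring (c : nat -> nat -> bool) : Prop :=
  forall m n, c m n = c n m.

Definition monochromatic (c : nat -> nat -> bool) (G : graph nat) : Prop :=
  exists b : bool, forall m n, adj G m n -> c m n = b.

Section Density.
Variable R : realType.

Definition upper_density (S : set nat) : \bar R :=
  limn_esup (fun n => ((count (fun k => k \in S) (iota 1 n))%:R / n%:R)%:E).

Definition graph_density (G : graph nat) : \bar R :=
  upper_density (vertices G).

(* Meant for countably infinite [H]. *)
Definition ramsey_upper_density (T : Type) (H : graph T) : \bar R :=
  ereal_sup [set l%:E | l in [set l : R |
    forall c, coloring c ->
      exists H' : graph nat, [/\ subgraph H' K_N, isomorphic H' H,
        monochromatic c H' & (l%:E <= graph_density H')%E]]].

Definition euclidean_dist (d : nat) (x y : 'rV[R]_d) : R :=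
  Num.sqrt (\sum_(i < d) (x 0 i - y 0 i) ^+ 2).

Lemma euclidean_distC (d : nat) (x y : 'rV[R]_d) :
  euclidean_dist x y = euclidean_dist y x.
Proof.
by congr Num.sqrt; apply: eq_bigr => i _; rewrite -sqrrN opprB.
Qed.

Lemma euclidean_dist0 (d : nat) (x : 'rV[R]_d) : euclidean_dist x x = 0.
Proof.
by rewrite /euclidean_dist big1 ?sqrtr0// => i _; rewrite subrr expr0n.
Qed.

Definition grid (d : nat) : graph 'rV[int]_d.
Proof.
refine (@Graph 'rV[int]_d setT
  (fun x y => euclidean_dist (map_mx intr x) (map_mx intr y) = 1) _ _ _).
- by [].
- by move=> x y; rewrite euclidean_distC.
- by move=> x; rewrite euclidean_dist0 => /esym/eqP; rewrite oner_eq0.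
Defined.

Local Open Scope ereal_scope.

(* The minimum of [A], and +oo if [A] has none. For continuous [g] the sets to
   which it is applied below are closed, so it is then +oo only on the empty
   set. *)
Definition ereal_min (A : set (\bar R)) : \bar R := xget +oo (A `&` lbound A).

(* A function [0, +oo) -> R is encoded as [g : R -> R], of which only the values
   at nonnegative arguments are ever used. *)
Definition Gamma_plus (gamma : R) (g : R -> R) (t : R) : \bar R :=
  ereal_min [set x%:E | x in [set x : R | 0 <= x /\ t <= gamma * x + g x]%R].

Definition Gamma_minus (gamma : R) (g : R -> R) (t : R) : \bar R :=
  ereal_min [set x%:E | x in [set x : R | 0 <= x /\ t <= gamma * x - g x]%R].

Definition h (gamma : R) : \bar R :=
  ereal_inf [set limf_esup
      (fun t : R => (Gamma_plus gamma g t + Gamma_minus gamma g t) * t^-1%:E)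
      (pinfty_nbhs R)
    | g in [set g : R -> R | g 0%R = 0%R /\ 1.-lipschitz_(`[0%R, +oo[) g]].

(* [h gamma] is finite when -1 < gamma < 1, which is the case in [f], so that
   [fine] only changes its type. The values of [f] off [0, +oo] are junk. *)
Definition f (l : \bar R) : R :=
  match l with
  | l%:E =>
    if l == 0%R then 1%R else
    (1 - 1 / (2 * l / (1 + l) ^+ 2 * fine (h ((l - 1) / (l + 1)))
              + 2 * l / (1 + l)))%R
  | _ => (1 / 2)%R
  end.

End Density.

(* Main.v *)
Require Import Defs.
From mathcomp Require Import all_boot all_order all_algebra.
From mathcomp Require Import all_classical all_reals all_analysis.
From mathcomp Require Import zify ring lra.
From mathcomp Require Import fintype finset.

Set Implicit Arguments.
Unset Strict Implicit.
Unset Printing Implicit Defensive.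
Import Order.TTheory GRing.Theory Num.Theory.
Import numFieldNormedType.Exports.

(** Put delta = 1 / (5 + 2 sqrt 2); the claimed density is 1 - delta, and the value
    h 0 = 8 + 4 sqrt 2 means that 1 / delta = 1 + h 0 / 2.

    Upper bound.  Every vertex gets a key, and an edge is coloured by the parity of the
    smaller key of its two ends ([key_colour]).  In a copy of the grid of colour b,
    translation by a basis vector injects the vertices of the copy whose key is at most k
    and has the wrong parity into the vertices whose key is at most k and has the right
    parity.  So the copy misses at least the excess of the wrong parity over the right one
    among the small keys.  The number of vertices with a given key is a sum of two
    consecutive Pell numbers, and the keys are laid out along the natural numbers in such a
    way that this excess is about delta n among the first n vertices, for both colours at
    once ([missing_vertices]).

    Lower bound.  An ultrafilter assigns to each vertex the colour that joins it to almost
    all vertices; let V be the class of vertices with colour kappa.  Finitely many vertices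
    of V have infinitely many common neighbours in colour kappa, so that vertices of V may
    be put freely on the even points of the grid, and the odd points be filled afterwards.
    In this way a copy covers V.  Vertices outside V are covered by means of complete
    bipartite blocks in colour kappa between V and its complement, which are placed in large
    boxes of the grid, where odd and even points are almost equally many ([grid_patches],
    [dense_copy]).  What is left is to find, for one of the two colours and for arbitrarily
    large n, disjoint blocks that together with V cover nearly (1 - delta) n of the first n
    vertices ([monochromatic_blocks]).

    The vertices are partitioned into boundedly many cells such that almost all pairs of
    cells from the two classes are full in one of the colours: large parts of the two cells
    always contain a block of that colour ([regularity]).  A matching between full cells can
    be turned into disjoint blocks ([blocks_of_matching]).  If the blocks are insufficient
    in both colours for all n in a long interval, then Hall's theorem gives, for each n, a
    set S n of vertices of the second class and a set T n of vertices of the first class,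
    each of which exceeds its neighbourhood by about delta n.  A pair between
    S m minus the neighbours of T n and T n minus the neighbours of S m is full in neither
    colour, so that one of these differences is small.  Consequently the sizes of the two
    neighbourhoods behave like the times at which a 1-Lipschitz function reaches the
    heights n and - n for the first time ([zigzag], [double_deficiency]), and the sum of two
    such times exceeds K n for some n whenever K < 8 + 4 sqrt 2 ([zigzag_slow]).

    The value of h 0 comes from the same inequality, together with the function whose graph
    consists of tents between consecutive powers of 1 + sqrt 2, pointing alternately up and
    down ([h_at_0]). *)

(** * Hall's theorem *)

Section Hall.
Variables (T U : finType).
Implicit Types (e : T -> U -> bool) (A S : {set T}) (B : {set U}).

Definition nbhd e S : {set U} := [set y | [exists x in S, e x y]].

Lemma nbhdP e S y : reflect (exists2 x, x \in S & e x y) (y \in nbhd e S).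
Proof.
rewrite inE; apply: (iffP existsP) => [[x /andP[]]|[x xS exy]]; first by exists x.
by exists x; rewrite xS.
Qed.

Definition saturates e A (f : T -> U) :=
  {in A &, injective f} /\ {in A, forall x, e x (f x)}.

(** Induction on the size of A.  If some proper nonempty S is tight, then S can be matched
    with its neighbourhood and the rest of A outside it; otherwise any edge at any point of
    A may be used, since removing one point of U keeps Hall's condition. *)
Lemma hall e A (y0 : U) : (forall S, S \subset A -> #|S| <= #|nbhd e S|) ->
  exists f, saturates e A f.
Proof.
have [n] := ubnP #|A|; elim: n e A => // n IH e A An hallA.
have [->|[a aA]] := set_0Vmem A.
  by exists (fun=> y0); split=> [x|x]; rewrite inE.
case: (boolP [exists S : {set T}, [&& S \proper A, S != set0 & #|nbhd e S| == #|S|]]).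
  case/existsP => S /and3P[SA S0 /eqP tight].
  have SA' := proper_sub SA.
  have [||f [fi fe]] := IH e S.
  - by apply: leq_trans (proper_card SA) _.
  - by move=> S' S'S; apply: hallA; apply: subset_trans S'S SA'.
  pose e' x y := e x y && (y \notin nbhd e S).
  have [||g [gi ge]] := IH e' (A :\: S).
  - apply: leq_trans (_ : #|A| <= n) => //; apply: proper_card; apply/properP; split.
      exact: subsetDl.
    have /set0Pn[x xS] := S0; exists x; first exact: (subsetP SA').
    by rewrite inE xS.
  - move=> S' S'A.
    have disj : [disjoint S & S'].
      rewrite disjoint_sym disjoints_subset; apply: (subset_trans S'A).
      by apply/subsetP => x; rewrite !inE => /andP[].
    have := hallA (S :|: S').
    rewrite cardsU (_ : S :&: S' = set0) ?cards0 ?subn0; last exact: disjoint_setI0.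
    rewrite subUset SA' (subset_trans S'A (subsetDl _ _)) => /(_ isT) h.
    suff : #|nbhd e (S :|: S')| <= #|nbhd e S| + #|nbhd e' S'| by lia.
    apply: leq_trans (leq_card_setU _ _); apply: subset_leq_card.
    apply/subsetP => y /nbhdP[x]; rewrite inE => /orP[xS exy|xS exy].
      by rewrite inE; apply/orP; left; apply/nbhdP; exists x.
    rewrite inE; case: (boolP (y \in nbhd e S)) => //= yS.
    by apply/nbhdP; exists x => //; rewrite /e' exy.
  have gS x : x \in A -> x \notin S -> x \in A :\: S by rewrite inE => -> ->.
  exists (fun x => if x \in S then f x else g x); split.
    move=> x y xA yA; case: ifPn => xS; case: ifPn => yS.
    - exact: fi.
    - move=> E; have /andP[_ /negP[]] := ge _ (gS _ yA yS).
      by rewrite -E; apply/nbhdP; exists x => //; exact: fe.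
    - move=> E; have /andP[_ /negP[]] := ge _ (gS _ xA xS).
      by rewrite E; apply/nbhdP; exists y => //; exact: fe.
    - by apply: gi; exact: gS.
  move=> x xA; case: ifPn => xS; first exact: fe.
  by case/andP: (ge _ (gS _ xA xS)).
move=> /existsPn loose.
have : 0 < #|nbhd e [set a]|.
  by apply: leq_trans (hallA _ _); rewrite ?cards1 // sub1set.
case/card_gt0P => b /nbhdP[_ /set1P -> eab].
pose e' x y := e x y && (y != b).
have [||f [fi fe]] := IH e' (A :\ a).
- by move: An; rewrite (cardsD1 a A) aA ltnS.
- move=> S SA.
  have [->|[c cS]] := set_0Vmem S; first by rewrite cards0.
  have SpA : S \proper A.
    apply/properP; split; first exact: subset_trans SA (subsetDl _ _).
    by exists a => //; apply/negP => /(subsetP SA); rewrite !inE eqxx.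
  have := loose S; rewrite SpA /= negb_and negbK.
  have -> : (S == set0) = false by apply/negP => /eqP S0; rewrite S0 inE in cS.
  move=> /= /negP ne; have := hallA S (proper_sub SpA).
  rewrite leq_eqVlt => /orP[/eqP h|h]; first by case: ne; rewrite h.
  suff : #|nbhd e S| <= #|nbhd e' S| + 1 by lia.
  rewrite -(cards1 b); apply: leq_trans (leq_card_setU _ _).
  apply: subset_leq_card; apply/subsetP => y /nbhdP[x xS exy].
  rewrite !inE; case: eqVneq => [_|yb]; first by rewrite orbT.
  by rewrite orbF; apply/existsP; exists x; rewrite xS /e' exy.
exists (fun x => if x == a then b else f x); split.
  move=> x y xA yA; case: eqVneq => [->|xa]; case: eqVneq => [->|ya] //.
  - by move=> E; have := fe y; rewrite !inE ya yA -E /e' eqxx andbF => /(_ isT).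
  - by move=> E; have := fe x; rewrite !inE xa xA E /e' eqxx andbF => /(_ isT).
  - by apply: fi; rewrite !inE ?xa ?ya.
move=> x xA; case: eqVneq => [->//|xa].
by have := fe x; rewrite !inE xa xA => /(_ isT) /andP[].
Qed.
End Hall.

(** Adding D points of U joined to everything reduces this to Hall's condition; the points
    matched with the added ones are discarded. *)
Lemma hall_deficiency (T U : finType) (e : T -> U -> bool) (A : {set T}) (D : nat) (y0 : U) :
  (forall S : {set T}, S \subset A -> #|S| <= #|nbhd e S| + D) ->
  exists (M : {set T}) (f : T -> U),
    [/\ M \subset A, #|A| <= #|M| + D & saturates e M f].
Proof.
move=> hallA.
pose e' x (z : U + 'I_D) := if z is inl y then e x y else true.
have [|f [fi fe]] := @hall T (U + 'I_D)%type e' A (inl y0).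
  move=> S SA; have [->|[c cS]] := set_0Vmem S; first by rewrite cards0.
  apply: leq_trans (hallA S SA) _.
  have -> : #|nbhd e S| + D =
      #|[set inl y | y in nbhd e S] :|: [set inr i | i in [set: 'I_D]] : {set U + 'I_D}|.
    rewrite cardsU (_ : _ :&: _ = set0); last first.
      by apply/setP => z; rewrite !inE; apply/negP => /andP[/imsetP[y _ ->] /imsetP[i _]].
    rewrite cards0 subn0 card_imset; last by move=> ? ? [].
    by rewrite card_imset ?cardsT ?card_ord // => ? ? [].
  apply: subset_leq_card; apply/subsetP => z; rewrite inE => /orP[] /imsetP[y hy ->].
    by move: hy => /nbhdP[x xS exy]; apply/nbhdP; exists x.
  by apply/nbhdP; exists c.
pose M := [set x in A | if f x is inl _ then true else false].
exists M, (fun x => if f x is inl y then y else y0); split.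
- by apply/subsetP => x; rewrite inE => /andP[].
- have -> : #|A| = #|M| + #|A :\: M|.
    by rewrite -(cardsID M A) (setIidPr _) //; apply/subsetP => x; rewrite inE => /andP[].
  rewrite leq_add2l.
  have fiD : {in A :\: M &, injective f}.
    by move=> x y /setDP[xA _] /setDP[yA _]; exact: fi.
  rewrite -(card_in_imset fiD) -[X in _ <= X](card_ord D) -cardsT.
  rewrite -(card_imset setT (f := @inr U 'I_D)); last by move=> ? ? [].
  apply: subset_leq_card; apply/subsetP => z /imsetP[x /setDP[xA xM] ->].
  move: xM; rewrite inE xA /=; case: (f x) => // i _; exact: imset_f.
split=> [x y|x].
  rewrite !inE => /andP[xA]; case E: (f x) => [u|//] _ /andP[yA].
  by case E': (f y) => [v|//] _ uv; apply: fi => //; rewrite E E' uv.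
rewrite !inE => /andP[xA]; have := fe x xA.
by case E: (f x) => [u|//].
Qed.

(** * Partitions into pairs of full cells *)

Lemma pigeonhole (T U : finType) (f : T -> U) (Y : {set T}) (P : {set U}) (s : nat) :
  {in Y, forall y, f y \in P} -> s * #|P| <= #|Y| -> 0 < #|P| ->
  exists2 u, u \in P & s <= #|[set y in Y | f y == u]|.
Proof.
move=> fP sP P0.
have [/existsP[u /andP[uP su]]|no] := boolP [exists u in P, s <= #|[set y in Y | f y == u]|].
  by exists u.
suff : #|Y| < s * #|P| by rewrite ltnNge sP.
rewrite -sum1_card (partition_big f (mem P)) //=.
have lt u : u \in P -> \sum_(y in Y | f y == u) 1 < s.
  move=> uP; move: no; rewrite negb_exists => /forallP/(_ u).
  rewrite uP /= -ltnNge; apply: leq_trans.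
  by rewrite -sum1_card ltnS leq_eqVlt; apply/orP; left; apply/eqP; apply: eq_bigl => y; rewrite inE.
case/card_gt0P: P0 => u0 u0P.
rewrite (bigD1 u0) //= (cardsD1 u0 P) u0P mulnDr muln1 -addSn leq_add ?lt //.
rewrite mulnC -sum_nat_const.
rewrite [X in _ <= X](eq_bigl (fun u => (u \in P) && (u != u0))); last first.
  by move=> u; rewrite !inE andbC.
by apply: leq_sum => u /andP[uP _]; apply/ltnW/lt.
Qed.

Lemma subset_of_card (T : finType) (X : {set T}) k : k <= #|X| ->
  exists2 Y : {set T}, Y \subset X & #|Y| = k.
Proof.
move=> kX; exists [set x in take k (enum X)].
  by apply/subsetP => x; rewrite inE => /mem_take; rewrite mem_enum.
by rewrite cardsE (card_uniqP (take_uniq _ (enum_uniq _))) size_takel // -cardE.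
Qed.

Section Blocks.
Variables (T : finType) (e : T -> T -> bool) (s : nat).
Implicit Types (X Y : {set T}) (kappa : bool).

(** A complete bipartite graph with s vertices on either side, all of whose edges have colour
    kappa. *)
Definition block kappa X Y :=
  [&& #|X| == s, #|Y| == s & [forall x in X, forall y in Y, e x y == kappa]].

Definition has_block kappa X Y :=
  [exists X' : {set T}, exists Y' : {set T},
    [&& X' \subset X, Y' \subset Y & block kappa X' Y']].

Lemma has_blockP kappa X Y :
  reflect (exists X' Y', [/\ X' \subset X, Y' \subset Y & block kappa X' Y'])
          (has_block kappa X Y).
Proof.
apply: (iffP existsP) => [[X' /existsP[Y' /and3P[]]]|[X' [Y' [h1 h2 h3]]]].
  by exists X', Y'.
by exists X'; apply/existsP; exists Y'; rewrite h1 h2.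
Qed.

Lemma has_blockS kappa X Y X1 Y1 : X \subset X1 -> Y \subset Y1 ->
  has_block kappa X Y -> has_block kappa X1 Y1.
Proof.
move=> hX hY /has_blockP[X' [Y' [h1 h2 h3]]]; apply/has_blockP; exists X', Y'.
by split=> //; [exact: subset_trans hX | exact: subset_trans hY].
Qed.

Definition bip_ramsey := s * 2 ^ (s + s) + (s + s).

(** Among the sets of neighbours in a fixed set of 2 s points of X, some set occurs for s
    points of Y; it or its complement has s elements. *)
Lemma bip_ramseyP X Y : bip_ramsey <= #|X| -> bip_ramsey <= #|Y| ->
  has_block true X Y || has_block false X Y.
Proof.
rewrite /bip_ramsey => hX hY.
have [X0 X0X cX0] := subset_of_card (leq_trans (leq_addl _ _) hX).
pose f y := [set x in X0 | e x y].
have fP : {in Y, forall y, f y \in powerset X0}.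
  by move=> y _; rewrite inE; apply/subsetP => x; rewrite inE => /andP[].
have [||A AX0 hA] := pigeonhole (s := s) fP.
- by rewrite card_powerset cX0 (leq_trans (leq_addr _ _) hY).
- by rewrite card_powerset expn_gt0.
have [Y' Y'Y cY'] := subset_of_card hA.
have Y'1 y : y \in Y' -> y \in Y /\ f y = A.
  by move=> /(subsetP Y'Y); rewrite inE => /andP[? /eqP].
have YY' : Y' \subset Y by apply/subsetP => y /Y'1[].
have AX : A \subset X0 by rewrite inE in AX0.
have [sA|sA] := leqP s #|A|.
  have [X' X'A cX'] := subset_of_card sA.
  apply/orP; left; apply/has_blockP; exists X', Y'; split => //.
    exact: subset_trans X'A (subset_trans AX X0X).
  rewrite /block cX' cY' !eqxx /=; apply/forall_inP => x xX'.
  apply/forall_inP => y /Y'1[_ fy]; rewrite eqb_id.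
  by have := subsetP X'A x xX'; rewrite -fy inE => /andP[].
have sA' : s <= #|X0 :\: A| by rewrite cardsDS // cX0; lia.
have [X' X'A cX'] := subset_of_card sA'.
apply/orP; right; apply/has_blockP; exists X', Y'; split => //.
  exact: subset_trans X'A (subset_trans (subsetDl _ _) X0X).
rewrite /block cX' cY' !eqxx /=; apply/forall_inP => x xX'.
apply/forall_inP => y /Y'1[_ fy]; rewrite eqbF_neg.
by have := subsetP X'A x xX'; rewrite -fy /f !inE; case: (x \in X0); rewrite ?andbF ?andbT.
Qed.

Variables (R B : {set T}) (q : nat).

Definition cell (L : finType) (lab : T -> L) (S : {set T}) i := [set x in S | lab x == i].

(** A qualitative substitute for regularity of positive density: parts of the two cells that
    contain at least the fraction 1/q of each always contain a block of colour kappa. *)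
Definition full (L : finType) (lab : T -> L) kappa i j :=
  [forall X : {set T}, forall Y : {set T},
    [&& X \subset cell lab R i, Y \subset cell lab B j,
        #|cell lab R i| <= q * #|X| & #|cell lab B j| <= q * #|Y|] ==> has_block kappa X Y].

Lemma fullPn (L : finType) (lab : T -> L) kappa i j :
  reflect (exists X Y, [/\ X \subset cell lab R i, Y \subset cell lab B j,
        #|cell lab R i| <= q * #|X|, #|cell lab B j| <= q * #|Y| & ~~ has_block kappa X Y])
   (~~ full lab kappa i j).
Proof.
rewrite negb_forall; apply: (iffP existsP) => -[X].
  by rewrite negb_forall => /existsP[Y]; rewrite negb_imply => /andP[/and4P[]]; exists X, Y.
move=> [Y [h1 h2 h3 h4 h5]]; exists X; rewrite negb_forall; apply/existsP; exists Y.
by rewrite h1 h2 h3 h4 h5.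
Qed.

Section Refine.
Variables (L : finType) (lab : T -> L).

Definition irregular := [set p in setX R B |
  ~~ full lab true (lab p.1) (lab p.2) && ~~ full lab false (lab p.1) (lab p.2)].

(** The number of null pairs is the potential that grows under refinement: a part of a
    pair of cells without a block has no block either. *)
Definition null_pairs := [set p in setX R B |
  ~~ has_block true (cell lab R (lab p.1)) (cell lab B (lab p.2))].

(** In cells below this size Ramsey's theorem does not apply to parts of relative size
    1/q. *)
Definition small_pairs := [set p in setX R B |
  (#|cell lab R (lab p.1)| < q * bip_ramsey) || (#|cell lab B (lab p.2)| < q * bip_ramsey)].

Lemma card_small_cells (S : {set T}) m : #|[set x in S | #|cell lab S (lab x)| < m]| <= #|L| * m.
Proof.
rewrite -sum1_card (partition_big lab predT) //=.
rewrite -[X in _ <= X]sum_nat_const; apply: leq_sum => i _.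
have [h|h] := ltnP #|cell lab S i| m; last first.
  rewrite big1 // => x /andP[]; rewrite inE => /andP[_ h'] /eqP E.
  by rewrite E ltnNge h in h'.
apply: leq_trans (ltnW h); rewrite sum1_card.
apply: subset_leq_card; apply/subsetP => x; rewrite !inE.
by rewrite unfold_in !inE => /andP[/andP[-> _] ->].
Qed.

Lemma card_small_pairs : #|small_pairs| <= 2 * (#|L| * (q * bip_ramsey) * #|T|).
Proof.
pose S1 (S : {set T}) := [set x in S | #|cell lab S (lab x)| < q * bip_ramsey].
have h : small_pairs \subset setX (S1 R) setT :|: setX setT (S1 B).
  apply/subsetP => -[x y]; rewrite !inE /= => /andP[/andP[-> ->]].
  by case/orP => ->; rewrite ?orbT.
apply: leq_trans (subset_leq_card h) _.
apply: leq_trans (leq_card_setU _ _) _.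
rewrite !cardsX cardsT mul2n -addnn [X in _ + X]mulnC.
by rewrite leq_add // leq_mul2r card_small_cells orbT.
Qed.

(** An irregular pair of cells that are not small contains large parts without a true block,
    but is not itself null: large parts of it without a false block contain a true one by
    Ramsey's theorem.  Splitting every cell along these parts makes at least the fraction
    1/q^2 of every such pair newly null. *)
Lemma refine_step : exists (L' : finType) (lab' : T -> L'),
  #|L'| = #|L| * 2 ^ (#|L| * #|L|) * 2 ^ (#|L| * #|L|) /\
  q * q * #|null_pairs| + #|irregular :\: small_pairs| <=
  q * q * #|[set p in setX R B |
    ~~ has_block true (cell lab' R (lab' p.1)) (cell lab' B (lab' p.2))]|.
Proof.
have [X [Y XY]] : exists (X Y : L * L -> {set T}), forall p,
    ~~ full lab true p.1 p.2 ->
   [/\ X p \subset cell lab R p.1, Y p \subset cell lab B p.2,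
     #|cell lab R p.1| <= q * #|X p|, #|cell lab B p.2| <= q * #|Y p|
     & ~~ has_block true (X p) (Y p)].
  pose W p (Z : {set T} * {set T}) :=
    [&& Z.1 \subset cell lab R p.1, Z.2 \subset cell lab B p.2,
     #|cell lab R p.1| <= q * #|Z.1|, #|cell lab B p.2| <= q * #|Z.2|
     & ~~ has_block true Z.1 Z.2].
  exists (fun p => (odflt (set0, set0) [pick Z | W p Z]).1),
    (fun p => (odflt (set0, set0) [pick Z | W p Z]).2).
  move=> p /fullPn[X [Y [h1 h2 h3 h4 h5]]].
  case: pickP => [Z /and5P[]//|/(_ (X, Y))].
  by rewrite /W /= h1 h2 h3 h4 h5.
pose L' : finType := (L * {ffun L * L -> bool} * {ffun L * L -> bool})%type.
pose lab' x : L' := (lab x, [ffun p => x \in X p], [ffun p => x \in Y p]).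
exists L', lab'; split.
  by rewrite !card_prod !card_ffun card_bool card_prod.
have cS S x : cell lab' S (lab' x) \subset cell lab S (lab x).
  by apply/subsetP => z; rewrite !inE => /andP[-> /eqP[->]] /=.
set N' := [set p in _ | _].
have NN' : null_pairs \subset N'.
  apply/subsetP => p; rewrite !inE => /andP[-> /=]; apply: contra.
  exact: has_blockS.
have -> : #|N'| = #|null_pairs| + #|N' :\: null_pairs|.
  by rewrite cardsDS // subnKC // subset_leq_card.
rewrite mulnDr leq_add2l.
rewrite -sum1_card -[#|N' :\: _|]sum1_card.
pose h (p : T * T) := (lab p.1, lab p.2).
rewrite (partition_big h predT) // [X in _ * _ * X](partition_big h predT) //=.
rewrite big_distrr /=; apply: leq_sum => -[i j] _; rewrite !sum1_card.
set I := (X in #|X| <= _).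
have [p0 p0I|I0] := pickP (mem I); last by rewrite (eq_card0 I0).
have Iij : #|I| <= #|setX (cell lab R i) (cell lab B j)|.
  apply: subset_leq_card; apply/subsetP => -[x y].
  rewrite unfold_in !inE /h /= => /andP[/andP[_ /andP[/andP[-> ->] _]]].
  by rewrite xpair_eqE.
move: p0I; rewrite /= unfold_in !inE /= => /andP[/andP[nsm /andP[h0 /andP[nft nff]]]] /eqP[E1 E2].
rewrite h0 /= E1 E2 in nsm; rewrite E1 E2 in nft nff.
move: nsm; rewrite negb_or -!leqNgt => /andP[c1 c2].
have [hX hY qX qY nXY] := XY (i, j) nft; rewrite /= in hX hY qX qY.
apply: (leq_trans Iij); rewrite cardsX.
apply: leq_trans (_ : (q * #|X (i, j)|) * (q * #|Y (i, j)|) <= _).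
  exact: leq_mul.
rewrite mulnACA -cardsX leq_mul2l; apply/orP; right.
apply: subset_leq_card; apply/subsetP => -[x y]; rewrite !inE /= => /andP[xX yY].
have := subsetP hX x xX; rewrite inE => /andP[xR /eqP lx].
have := subsetP hY y yY; rewrite inE => /andP[yB /eqP ly].
rewrite unfold_in !inE /= xR yB /= !lx !ly negbK /h /= lx ly eqxx andbT; apply/andP; split.
  apply: contraT => nb; case/fullPn: nff => X2 [Y2 [g1 g2 g3 g4 g5]].
  have q0 : 0 < q.
    have : 0 < #|cell lab R i| by apply/card_gt0P; exists x; exact: (subsetP hX).
    by move/leq_trans/(_ qX); rewrite muln_gt0 => /andP[].
  have := bip_ramseyP (X := X2) (Y := Y2); rewrite (negbTE g5) orbF.
  have r1 : bip_ramsey <= #|X2| by rewrite -(leq_pmul2l q0) (leq_trans c1 g3).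
  have r2 : bip_ramsey <= #|Y2| by rewrite -(leq_pmul2l q0) (leq_trans c2 g4).
  move=> /(_ r1 r2) hb.
  by case/negP: nb; exact: has_blockS hb.
apply: contra nXY; apply: has_blockS.
  by apply/subsetP => z; rewrite inE => /andP[_ /eqP[_ /ffunP/(_ (i, j))]]; rewrite !ffunE xX => ->.
by apply/subsetP => z; rewrite inE => /andP[_ /eqP[_ _ /ffunP/(_ (i, j))]]; rewrite !ffunE yY => ->.
Qed.
End Refine.

(** Each refinement cuts every cell by one set for each of the l * l pairs, twice. *)
Fixpoint regularity_bound k l :=
  if k is k'.+1 then regularity_bound k' (l * 2 ^ (l * l) * 2 ^ (l * l)) else l.

Lemma leq_regularity_bound k l : l <= regularity_bound k l.
Proof.
elim: k l => //= k IH l; apply: leq_trans (IH _).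
by rewrite -mulnA leq_pmulr // muln_gt0 !expn_gt0.
Qed.

Lemma refine_gain g (L : finType) (lab : T -> L) :
  2 * g * (2 * (#|L| * (q * bip_ramsey))) <= #|T| ->
  #|T| ^ 2 < g * #|irregular lab| ->
  exists (L' : finType) (lab' : T -> L'),
  #|L'| = #|L| * 2 ^ (#|L| * #|L|) * 2 ^ (#|L| * #|L|) /\
  2 * g * (q * q) * #|null_pairs lab| + #|T| ^ 2 <
  2 * g * (q * q) * #|null_pairs lab'|.
Proof.
move=> h2 bad; have [L' [lab' [cL' st]]] := refine_step lab.
exists L', lab'; split=> //; rewrite -/(null_pairs lab') in st.
have small : 2 * g * #|small_pairs lab| <= #|T| ^ 2.
  apply: leq_trans (_ : 2 * g * (2 * (#|L| * (q * bip_ramsey) * #|T|)) <= _).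
    by rewrite leq_mul2l card_small_pairs orbT.
  by rewrite -mulnn [2 * (_ * _ * _)]mulnA [_ * (_ * #|T|)]mulnA leq_mul2r h2 orbT.
have inc : #|irregular lab| <= #|irregular lab :\: small_pairs lab| + #|small_pairs lab|.
  rewrite -[X in X <= _](cardsID (small_pairs lab)) addnC leq_add2l.
  by rewrite subset_leq_card // subsetIr.
have inc' := leq_mul (leqnn (2 * g)) inc.
have st' := leq_mul (leqnn (2 * g)) st.
move: bad small inc' st'; rewrite !mulnDr !mulnA.
by move: (#|T| ^ 2); lia.
Qed.

(** k bounds the number of gains that are still possible before the null pairs would
    outnumber all pairs. *)
Lemma regularity_iter (g k : nat) (L : finType) (lab : T -> L) :
  2 * g * (q * q) * #|T| ^ 2 <= 2 * g * (q * q) * #|null_pairs lab| + k * #|T| ^ 2 ->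
  2 * g * (2 * (regularity_bound k #|L| * (q * bip_ramsey))) <= #|T| ->
  exists (L' : finType) (lab' : T -> L'), #|L'| <= regularity_bound k #|L| /\
   g * #|irregular lab'| <= #|T| ^ 2.
Proof.
elim: k L lab => [|k IH] L lab h1 h2.
all: have [good|bad] := leqP (g * #|irregular lab|) (#|T| ^ 2);
  first by exists L, lab; split=> //; exact: leq_regularity_bound.
all: have h3 : 2 * g * (2 * (#|L| * (q * bip_ramsey))) <= #|T| by
  apply: leq_trans h2; rewrite leq_mul // leq_mul // leq_mul // leq_regularity_bound.
all: have [L' [lab' [cL' st]]] := refine_gain h3 bad.
- have ub : #|null_pairs lab'| <= #|T| ^ 2.
    by rewrite -mulnn -card_prod; exact: max_card.
  have := leq_mul (leqnn (2 * g * (q * q))) ub.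
  by move: h1 st; move: (#|T| ^ 2) (_ * #|_|) (_ * #|_|) (_ * _ * #|T| ^ 2); lia.
- have [||L2 [lab2 [h4 h5]]] := IH L' lab'; last by exists L2, lab2; rewrite /= -cL'.
    by move: h1 st; rewrite mulSn; move: (#|T| ^ 2) (_ * #|_|) (_ * #|_|) => *; lia.
  by rewrite cL'.
Qed.
End Blocks.

(** Here g measures the exceptional pairs.  They cannot be avoided: in a half graph the pairs
    of cells on the diagonal are full in neither colour. *)
Theorem regularity (s q g : nat) : exists K N0 : nat,
  forall (T : finType) (e : T -> T -> bool) (R B : {set T}), N0 <= #|T| ->
  exists (L : finType) (lab : T -> L), #|L| <= K /\
    g * #|irregular e s R B q lab| <= #|T| ^ 2.
Proof.
exists (regularity_bound (2 * g * (q * q)) 1).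
exists (2 * g * (2 * (regularity_bound (2 * g * (q * q)) 1 * (q * bip_ramsey s)))).
move=> T e R B hN.
have := @regularity_iter T e s R B q g (2 * g * (q * q)) unit (fun=> tt).
by rewrite card_unit; apply=> //; rewrite leq_addl.
Qed.

(** * Disjoint blocks from a matching *)

(** The pairs of cells are used in proportions m i j, a fractional matching of the cells.
    This is more flexible than using the matched vertices themselves: a block may be taken
    anywhere in the unused parts of the two cells, and so it exists as long as these parts
    stay above the thresholds tA and tW. *)
Section DisjointBlocks.
Variables (T L : finType) (lab : T -> L) (fullp : L -> L -> bool).
Variables (blkp : {set T} -> {set T} -> bool) (s : nat).
Hypothesis s0 : 0 < s.
Hypothesis blkp_card : forall X Y, blkp X Y -> #|X| = s /\ #|Y| = s.
Implicit Types (A W : {set T}) (F : seq ({set T} * {set T})).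

Definition block_family A W F :=
  all (fun p : {set T} * {set T} => [&& p.1 \subset A, p.2 \subset W & blkp p.1 p.2]) F &&
  pairwise (fun p p' : {set T} * {set T} => [disjoint p.1 & p'.1] && [disjoint p.2 & p'.2]) F.

Variables (A0 W0 : {set T}) (tA tW : L -> nat).
Hypothesis find_block : forall i j, fullp i j -> forall X Y : {set T},
  X \subset cell lab A0 i -> Y \subset cell lab W0 j -> tA i <= #|X| -> tW j <= #|Y| ->
  exists X' Y' : {set T}, [/\ X' \subset X, Y' \subset Y & blkp X' Y'].

Lemma cellS (A A' : {set T}) i : A \subset A' -> cell lab A i \subset cell lab A' i.
Proof.
by move=> AA'; apply/subsetP => x; rewrite !inE => /andP[/(subsetP AA') -> ->].
Qed.

Lemma cellD (A X : {set T}) i j : X \subset cell lab A i ->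
  #|cell lab (A :\: X) j| = #|cell lab A j| - (if j == i then #|X| else 0).
Proof.
move=> XA; case: eqVneq => [->|ji].
  rewrite -cardsDS //; congr #|pred_of_set _|.
  by apply/setP => x; rewrite !inE andbA.
rewrite subn0; congr #|pred_of_set _|; apply/setP => x; rewrite !inE.
case: eqP => [E|]; rewrite ?andbF ?andbT //.
case: (boolP (x \in X)) => //= /(subsetP XA); rewrite inE => /andP[_ /eqP E'].
by rewrite -E -E' eqxx in ji.
Qed.

(** Blocks are taken greedily.  When no more can be taken, every pair (i, j) either has
    m i j < s, or one of its cells has been used up to the threshold; the cells of the
    second sort account for at most the sum of the thresholds. *)
Lemma blocks_of_counts (m : L -> L -> nat) A W :
  A \subset A0 -> W \subset W0 -> (forall i j, 0 < m i j -> fullp i j) ->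
  (forall i, \sum_j m i j <= #|cell lab A i|) ->
  (forall j, \sum_i m i j <= #|cell lab W j|) ->
  exists2 F, block_family A W F & \sum_i \sum_j m i j <=
    s * size F + (s * (#|L| * #|L|) + (\sum_i tA i + \sum_j tW j)).
Proof.
have [n] := ubnP (\sum_i \sum_j m i j).
elim: n m A W => // n IH m A W mn AA WW mfl rowm colm.
case: (boolP [exists i, exists j, [&& s <= m i j, tA i <= #|cell lab A i| & tW j <= #|cell lab W j|]]).
  case/existsP => i /existsP[j /and3P[sm ci cj]].
  have [X [Y [XA YW bXY]]] := find_block (mfl i j (leq_trans s0 sm)) (cellS i AA) (cellS j WW) ci cj.
  have [cX cY] := blkp_card bXY.
  pose m' i' j' := if (i' == i) && (j' == j) then m i j - s else m i' j'.
  have mij : m' i j = m i j - s by rewrite /m' !eqxx.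
  have rowE i' : \sum_j' m i' j' = \sum_j' m' i' j' + (if i' == i then s else 0).
    case: eqVneq => [->|ii]; last first.
      by rewrite addn0; apply: eq_bigr => j' _; rewrite /m' (negbTE ii).
    rewrite (bigD1 j) //= [in RHS](bigD1 j) //= mij addnAC subnK //.
    congr (_ + _); apply: eq_bigr => j' /negbTE jj; by rewrite /m' jj andbF.
  have colE j' : \sum_i' m i' j' = \sum_i' m' i' j' + (if j' == j then s else 0).
    case: eqVneq => [->|jj]; last first.
      by rewrite addn0; apply: eq_bigr => i' _; rewrite /m' (negbTE jj) andbF.
    rewrite (bigD1 i) //= [in RHS](bigD1 i) //= mij addnAC subnK //.
    congr (_ + _); apply: eq_bigr => i' /negbTE ii; by rewrite /m' ii.
  have tot : \sum_i \sum_j m i j = \sum_i \sum_j m' i j + s.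
    rewrite (eq_bigr _ (fun i' _ => rowE i')) big_split /= -big_mkcond /=.
    by rewrite big_pred1_eq.
  have [||||||F fF hF] := IH m' (A :\: X) (W :\: Y).
  - by move: mn; rewrite tot; lia.
  - exact: subset_trans (subsetDl _ _) AA.
  - exact: subset_trans (subsetDl _ _) WW.
  - move=> i' j'; rewrite /m'; case: ifP => [/andP[/eqP -> /eqP ->]|_]; last exact: mfl.
    by move=> _; apply: mfl; exact: leq_trans sm.
  - move=> i'; rewrite (cellD _ XA) cX; have := rowm i'; rewrite rowE.
    by case: ifP => _; lia.
  - move=> j'; rewrite (cellD _ YW) cY; have := colm j'; rewrite colE.
    by case: ifP => _; lia.
  have XA' : X \subset A.
    by apply: subset_trans XA _; apply/subsetP => x; rewrite inE => /andP[].
  have YW' : Y \subset W.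
    by apply: subset_trans YW _; apply/subsetP => x; rewrite inE => /andP[].
  exists ((X, Y) :: F); last by rewrite tot /= mulnS addnC -addnA leq_add2l.
  case/andP: fF => aF pF; apply/andP; split => /=.
    rewrite XA' YW' bXY /=; apply: sub_all aF => p /and3P[h1 h2 ->].
    by rewrite (subset_trans h1 (subsetDl _ _)) (subset_trans h2 (subsetDl _ _)).
  rewrite pF andbT; apply: sub_all aF => p /and3P[h1 h2 _].
  rewrite ![[disjoint X & _]]disjoint_sym ![[disjoint Y & _]]disjoint_sym !disjoints_subset.
  by rewrite (subset_trans h1) ?(subset_trans h2) // setDE subsetIr.
rewrite negb_exists => /forallP no.
exists [::]; first by [].
rewrite muln0 add0n.
pose bA i := #|cell lab A i| < tA i. pose bW j := #|cell lab W j| < tW j.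
apply: leq_trans (_ : \sum_i \sum_j (s +
    ((if bA i then m i j else 0) + (if bW j then m i j else 0))) <= _).
  apply: leq_sum => i _; apply: leq_sum => j _.
  have := no i; rewrite negb_exists => /forallP/(_ j).
  rewrite !negb_and -!ltnNge -/(bA i) -/(bW j).
  by case: (bA i); case: (bW j); rewrite /= ?orbT ?orbF //; lia.
under eq_bigr => i _ do rewrite big_split /= big_split /=.
rewrite big_split /= big_split /= leq_add //.
  by rewrite sum_nat_const sum_nat_const mulnA mulnC.
rewrite leq_add //.
  apply: leq_sum => i _; case: (boolP (bA i)) => h; last by rewrite big1.
  exact: leq_trans (rowm i) (ltnW h).
rewrite exchange_big /=; apply: leq_sum => j _.
case: (boolP (bW j)) => h; last by rewrite big1.
exact: leq_trans (colm j) (ltnW h).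
Qed.
End DisjointBlocks.

Lemma sum_card_cell (T L : finType) (lab : T -> L) (S : {set T}) :
  \sum_i #|cell lab S i| = #|S|.
Proof.
rewrite -[in RHS]sum1_card (partition_big lab predT) //=; apply: eq_bigr => i _.
by rewrite -sum1_card; apply: eq_bigl => x; rewrite inE.
Qed.

Lemma sum_thresholds (T L : finType) (lab : T -> L) (S : {set T}) q :
  q * \sum_i (#|cell lab S i| %/ q).+1 <= #|S| + q * #|L|.
Proof.
under eq_bigr => i _ do rewrite -addn1.
rewrite big_split /= sum1_card cardT -cardE mulnDr leq_add2r.
rewrite -(sum_card_cell lab) big_distrr /=; apply: leq_sum => i _.
by rewrite mulnC leq_trunc_div.
Qed.

(** Counting the edges of a matching between the cells gives a fractional matching. *)
Lemma blocks_of_matching (T L : finType) (lab : T -> L) (fullp : L -> L -> bool)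
    (blkp : {set T} -> {set T} -> bool) (s q : nat) (A0 A W M : {set T}) (f : T -> T) :
  0 < s -> 0 < q -> (forall X Y, blkp X Y -> #|X| = s /\ #|Y| = s) ->
  (forall i j, fullp i j -> forall X Y : {set T},
    X \subset cell lab A0 i -> Y \subset cell lab W j ->
    #|cell lab A0 i| <= q * #|X| -> #|cell lab W j| <= q * #|Y| ->
    exists X' Y' : {set T}, [/\ X' \subset X, Y' \subset Y & blkp X' Y']) ->
  A \subset A0 -> M \subset A ->
  saturates (fun x y => (y \in W) && fullp (lab x) (lab y)) M f ->
  exists2 F, block_family blkp A W F &
    q * #|M| <= q * (s * size F) + q * (s * (#|L| * #|L|) + 2 * #|L|) + (#|A0| + #|W|).
Proof.
move=> s0 q0 bc ext AA0 MA [fi fe].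
pose m i j := #|[set x in M | (lab x == i) && (lab (f x) == j)]|.
have thE a b : (a %/ q).+1 <= b -> a <= q * b.
  by move=> h; apply: ltnW; rewrite mulnC -ltn_divLR.
have [|i j|i|j|F fF hF] := @blocks_of_counts T L lab fullp blkp s s0 bc A0 W
  (fun i => (#|cell lab A0 i| %/ q).+1) (fun i => (#|cell lab W i| %/ q).+1) _ m A W AA0 (subxx _).
- by move=> i j fij X Y XA YW /thE h1 /thE h2; apply: (ext i j).
- case/card_gt0P => x; rewrite inE => /and3P[xM /eqP <- /eqP <-].
  by case/andP: (fe x xM).
- apply: leq_trans (subset_leq_card (cellS lab i MA)).
  rewrite -[in X in _ <= X]sum1_card (partition_big (lab \o f) predT) //=.
  apply: leq_sum => j _; rewrite /m -sum1_card; apply: eq_leq.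
  by apply: eq_bigl => x; rewrite !inE andbA.
- have : #|[set f x | x in M & lab (f x) == j]| <= #|cell lab W j|.
    apply: subset_leq_card; apply/subsetP => y /imsetP[x]; rewrite !inE => /andP[xM lx] ->.
    by rewrite lx andbT; case/andP: (fe x xM).
  apply: leq_trans; rewrite card_in_imset; last first.
    by move=> x y; rewrite !inE => /andP[xM _] /andP[yM _]; exact: fi.
  rewrite -[in X in _ <= X]sum1_card (partition_big lab predT) //=.
  apply: leq_sum => i _; rewrite /m -sum1_card; apply: eq_leq.
  by apply: eq_bigl => x; rewrite !inE -andbA [X in _ && X]andbC.
exists F => //.
have -> : #|M| = \sum_i \sum_j m i j.
  rewrite -sum1_card (partition_big lab predT) //=; apply: eq_bigr => i _.
  rewrite (partition_big (lab \o f) predT) //=; apply: eq_bigr => j _.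
  by rewrite /m -sum1_card; apply: eq_bigl => x; rewrite !inE andbA.
apply: leq_trans (leq_mul (leqnn q) hF) _.
have h1 := sum_thresholds lab A0 q; have h2 := sum_thresholds lab W q.
by rewrite !mulnDr !mulnA; lia.
Qed.

(** * Finite partial embeddings *)

(** Odd points are required to have all their neighbours in the patch, since they will carry
    vertices with no neighbours but those in their own block. *)
Definition has_patches (T : eqType) (nb : T -> seq T) (par : T -> bool) k l :=
  forall D : seq T, exists I J : seq T,
  [/\ [/\ uniq I, uniq J, size I = k & size J = l], all par I /\ ~~ has par J,
    (forall x y, x \in I -> y \in nb x -> y \in J) & ~~ has (mem D) (I ++ J)].

Section PartialEmbedding.
Variables (T : eqType) (nb : T -> seq T) (par : T -> bool).
Variables (c : nat -> nat -> bool) (W : pred nat) (kappa : bool).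
Hypothesis par_nb : forall x y, y \in nb x -> par y = ~~ par x.
Hypothesis fresh_even : forall D : seq T, exists2 x, ~~ par x & x \notin D.
Hypothesis fresh_vertex : forall B : seq nat, exists2 w, W w & w \notin B.
Hypothesis common_neighbour : forall F B : seq nat, all W F ->
  exists2 z, z \notin B & all (fun w => c w z == kappa) F.

Implicit Types p : seq (T * nat).

(** Even points carry vertices of W.  An odd point is only placed after all its neighbours,
    so that a partial embedding can always be extended at the remaining odd points. *)
Definition edges_ok p x v := if par x
  then forall y, y \in nb x -> exists2 w, (y, w) \in p & c w v = kappa
  else W v.

Definition partial_embedding p :=
  [/\ uniq (unzip1 p), uniq (unzip2 p) & forall x v, (x, v) \in p -> edges_ok p x v].

Lemma edges_okS p p' x v : {subset p <= p'} -> edges_ok p x v -> edges_ok p' x v.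
Proof.
rewrite /edges_ok => pp'; case: (par x) => // h y /h[w yw cw].
by exists w => //; apply: pp'.
Qed.

Lemma partial_embedding_cons p x v : partial_embedding p ->
  x \notin unzip1 p -> v \notin unzip2 p -> edges_ok p x v ->
  partial_embedding ((x, v) :: p).
Proof.
move=> [u1 u2 ok] hx hv xv; split=> /=; rewrite ?hx ?hv //.
have S : {subset p <= (x, v) :: p} by move=> z; rewrite inE orbC => ->.
move=> y w; rewrite inE => /predU1P[[-> ->]|yw]; apply: edges_okS S _ => //.
exact: ok.
Qed.

Definition extends p p' := partial_embedding p' /\ {subset p <= p'}.

Lemma extends_trans p p' p'' : extends p p' -> extends p' p'' -> extends p p''.
Proof. by move=> [_ h1] [h2 h3]; split=> // x /h1/h3. Qed.

Lemma extend_even p x : partial_embedding p -> ~~ par x ->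
  exists2 p', extends p p' & x \in unzip1 p'.
Proof.
move=> pp ex; have [xp|xp] := boolP (x \in unzip1 p).
  by exists p => //; split.
have [w Ww wp] := fresh_vertex (unzip2 p).
exists ((x, w) :: p); last by rewrite inE eqxx.
split; last by move=> z; rewrite inE orbC => ->.
by apply: partial_embedding_cons => //; rewrite /edges_ok (negbTE ex).
Qed.

Lemma extend_evens (s : seq T) p : partial_embedding p -> all (fun x => ~~ par x) s ->
  exists2 p', extends p p' & {subset s <= unzip1 p'}.
Proof.
elim: s p => [|x s IH] p pp /=; first by exists p => //; split.
case/andP => ex es; have [p1 p1E xp1] := extend_even pp ex.
have [p2 p2E sp2] := IH p1 (proj1 p1E) es.
exists p2; first exact: extends_trans p1E p2E.
move=> y; rewrite inE => /predU1P[->|/sp2 //].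
case/mapP: xp1 => z zp1 ->; apply: map_f; exact: (proj2 p2E).
Qed.

(** An odd point is placed by first placing its neighbours and then choosing a common
    neighbour of the vertices that they carry. *)
Lemma extend_point p x : partial_embedding p ->
  exists2 p', extends p p' & x \in unzip1 p'.
Proof.
move=> pp; have [ox|] := boolP (par x); last exact: extend_even.
have [|p1 p1E nbp1] := @extend_evens (nb x) p pp.
  by apply/allP => y /par_nb ->; rewrite ox.
have [xp|xp] := boolP (x \in unzip1 p1); first by exists p1.
have [pp1 _] := p1E; have [_ _ ok1] := pp1.
pose F := [seq q.2 | q <- p1 & q.1 \in nb x].
have WF : all W F.
  apply/allP => v /mapP[[y w]]; rewrite mem_filter /= => /andP[ynb yw] ->.
  by have := ok1 _ _ yw; rewrite /edges_ok (par_nb ynb) ox.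
have [z zp zF] := common_neighbour (unzip2 p1) WF.
exists ((x, z) :: p1); last by rewrite inE eqxx.
apply: extends_trans p1E _; split; last by move=> y; rewrite inE orbC => ->.
apply: partial_embedding_cons => //; rewrite /edges_ok ox => y ynb.
have /mapP[[y' w] yw /= E] := nbp1 y ynb; rewrite -{y'}E in yw; exists w => //.
apply/eqP; apply: (allP zF); apply/mapP; exists (y, w) => //.
by rewrite mem_filter /= ynb.
Qed.

Lemma extend_vertex p w : partial_embedding p -> W w ->
  exists2 p', extends p p' & w \in unzip2 p'.
Proof.
move=> pp Ww; have [wp|wp] := boolP (w \in unzip2 p); first by exists p => //; split.
have [x ex xp] := fresh_even (unzip1 p).
exists ((x, w) :: p); last by rewrite inE eqxx.
split; last by move=> z; rewrite inE orbC => ->.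
by apply: partial_embedding_cons => //; rewrite /edges_ok (negbTE ex).
Qed.

Lemma unzip2S p p' : {subset p <= p'} -> {subset unzip2 p <= unzip2 p'}.
Proof. by move=> h v /mapP[z /h zp ->]; exact: map_f. Qed.

Lemma extend_vertices (s : seq nat) p : partial_embedding p -> all W s ->
  exists2 p', extends p p' & {subset s <= unzip2 p'}.
Proof.
elim: s p => [|x s IH] p pp /=; first by exists p => //; split.
case/andP => ex es; have [p1 p1E xp1] := extend_vertex pp ex.
have [p2 p2E sp2] := IH p1 (proj1 p1E) es.
exists p2; first exact: extends_trans p1E p2E.
move=> y; rewrite inE => /predU1P[->|/sp2 //].
exact: unzip2S (proj2 p2E) _ xp1.
Qed.

Variables (k l : nat).
Hypothesis fresh_patch : has_patches nb par k l.

Definition vertex_block (X Y : seq nat) :=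
  [/\ uniq (X ++ Y), size X = k, size Y = l, all W Y &
   {in X & Y, forall v w, c w v = kappa}].

Lemma partial_embedding_evens (J : seq T) (Y : seq nat) p : partial_embedding p ->
  size J = size Y -> uniq J -> uniq Y -> ~~ has par J -> all W Y ->
  ~~ has (mem (unzip1 p)) J -> ~~ has (mem (unzip2 p)) Y ->
  partial_embedding (zip J Y ++ p).
Proof.
move=> pp; elim: J Y => [|x J IH] [|v Y] //= [sJY] /andP[xJ uJ] /andP[vY uY].
rewrite !negb_or => /andP[ex eJ] /andP[Wv WY] /andP[xp Jp] /andP[vp Yp].
apply: partial_embedding_cons.
- exact: IH.
- by rewrite /unzip1 map_cat mem_cat negb_or -/unzip1 unzip1_zip ?sJY // xJ.
- by rewrite /unzip2 map_cat mem_cat negb_or -/unzip2 unzip2_zip ?sJY // vY.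
- by rewrite /edges_ok (negbTE ex).
Qed.

Lemma partial_embedding_odds (I : seq T) (X : seq nat) p : partial_embedding p ->
  size I = size X -> uniq I -> uniq X -> all par I ->
  (forall x v y, x \in I -> v \in X -> y \in nb x -> exists2 w, (y, w) \in p & c w v = kappa) ->
  ~~ has (mem (unzip1 p)) I -> ~~ has (mem (unzip2 p)) X ->
  partial_embedding (zip I X ++ p).
Proof.
move=> pp; elim: I X => [|x I IH] [|v X] //= [sIX] /andP[xI uI] /andP[vX uX].
move=> /andP[ox oI] ok; rewrite !negb_or => /andP[xp Ip] /andP[vp Xp].
apply: partial_embedding_cons.
- apply: IH => // y w z yI wX; apply: ok; by rewrite inE ?yI ?wX orbT.
- by rewrite /unzip1 map_cat mem_cat negb_or -/unzip1 unzip1_zip ?sIX // xI.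
- by rewrite /unzip2 map_cat mem_cat negb_or -/unzip2 unzip2_zip ?sIX // vX.
- rewrite /edges_ok ox => y ynb.
  have [|||w yw cw] := ok x v y; rewrite ?inE ?eqxx //.
  by exists w => //; rewrite mem_cat yw orbT.
Qed.

(** X goes to the odd points of a fresh patch and Y to the even ones. *)
Lemma extend_block X Y p : partial_embedding p -> vertex_block X Y ->
  ~~ has (mem (unzip2 p)) (X ++ Y) ->
  exists2 p', extends p p' & unzip2 p' = X ++ Y ++ unzip2 p.
Proof.
move=> pp [uXY sX sY WY cXY]; rewrite has_cat negb_or => /andP[Xp Yp].
have [I [J [[uI uJ sI sJ] [oI eJ] nIJ]]] := fresh_patch (unzip1 p).
rewrite has_cat negb_or => /andP[Ip Jp].
move: uXY; rewrite cat_uniq => /and3P[uX XY uY].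
have pJ : partial_embedding (zip J Y ++ p).
  by apply: partial_embedding_evens; rewrite // sJ sY.
have E1 : unzip1 (zip J Y ++ p) = J ++ unzip1 p.
  by rewrite /unzip1 map_cat -/unzip1 unzip1_zip // sJ sY.
have E2 : unzip2 (zip J Y ++ p) = Y ++ unzip2 p.
  by rewrite /unzip2 map_cat -/unzip2 unzip2_zip // sJ sY.
exists (zip I X ++ zip J Y ++ p); last first.
  by rewrite -E2 {1}/unzip2 map_cat -/unzip2 unzip2_zip // sI sX.
split; last by move=> z zp; rewrite !mem_cat zp !orbT.
apply: partial_embedding_odds => //; first by rewrite sI sX.
- move=> x v y xI vX /(nIJ _ _ xI) yJ.
  have yY : index y J < size Y by rewrite sY -sJ index_mem.
  exists (nth 0 Y (index y J)); last by apply: cXY => //; exact: mem_nth.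
  rewrite mem_cat; apply/orP; left.
  have -> : (y, nth 0 Y (index y J)) = nth (y, 0) (zip J Y) (index y J).
    by rewrite nth_zip ?sJ ?sY // nth_index.
  by apply: mem_nth; rewrite size_zip leq_min yY index_mem yJ.
- rewrite E1; apply/hasPn => x xI; rewrite /= mem_cat negb_or.
  rewrite (hasPn Ip _ xI) andbT; apply/negP => xJ.
  by have := hasPn eJ _ xJ; rewrite (allP oI).
- rewrite E2; apply/hasPn => v vX; rewrite /= mem_cat negb_or.
  rewrite (hasPn Xp _ vX) andbT; apply/negP => vY.
  by case/negP: XY; apply/hasP; exists v.
Qed.

Lemma extend_blocks (F : seq (seq nat * seq nat)) p : partial_embedding p ->
  (forall b, b \in F -> vertex_block b.1 b.2) ->
  uniq (flatten [seq b.1 ++ b.2 | b <- F]) ->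
  ~~ has (mem (unzip2 p)) (flatten [seq b.1 ++ b.2 | b <- F]) ->
  exists2 p', extends p p' & {subset flatten [seq b.1 | b <- F] <= unzip2 p'}.
Proof.
elim: F p => [|[X Y] F IH] p pp /= hF; first by exists p => //; split.
rewrite cat_uniq => /and3P[_ XYF uF]; rewrite has_cat negb_or => /andP[XYp Fp].
have [|p1 p1E E] := @extend_block X Y p pp _ XYp; first by apply: (hF (X, Y)); rewrite inE eqxx.
have [|||p2 p2E sp2] := IH p1 (proj1 p1E).
- by move=> b bF; apply: hF; rewrite inE bF orbT.
- by [].
- apply/hasPn => v vF; rewrite /= E catA mem_cat negb_or (hasPn Fp _ vF) andbT.
  exact: (hasPn XYF).
exists p2; first exact: extends_trans p1E p2E.
move=> v; rewrite mem_cat => /orP[vX|/sp2 //].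
by apply: (unzip2S (proj2 p2E)); rewrite E mem_cat vX.
Qed.
End PartialEmbedding.

(** * A colouring built from Pell numbers *)

Fixpoint pell_pair n := if n is n'.+1 then let: (a, b) := pell_pair n' in (b, 2 * b + a) else (0, 1).
(** The Pell numbers 0, 1, 2, 5, 12, ... *)
Definition pell n := (pell_pair n).1.

Lemma pellSS n : pell n.+2 = 2 * pell n.+1 + pell n.
Proof. by rewrite /pell /=; case: (pell_pair n). Qed.

Lemma pell_gt0 n : 0 < pell n.+1.
Proof. by elim: n => [|n IH] //; rewrite pellSS; lia. Qed.

Lemma leq_pell n : pell n <= pell n.+1.
Proof. by case: n => // n; rewrite pellSS; lia. Qed.

Definition alternating m (x y : nat) := flatten (nseq m [:: x; y]).

Lemma size_alternating m x y : size (alternating m x y) = 2 * m.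
Proof. by elim: m => //= m; rewrite /alternating => ->; lia. Qed.

Lemma count_take_alternating (a : pred nat) m t x y : t <= 2 * m ->
  count a (take t (alternating m x y)) = a x * uphalf t + a y * t./2.
Proof.
elim: m t => [|m IH] [|[|t]] tm //=; rewrite ?take0 ?muln0 ?muln1 ?addn0 //.
rewrite -/(alternating m x y) IH; last by lia.
by rewrite /=; case: (a x); case: (a y); lia.
Qed.

Lemma count_take_nseq (a : pred nat) r n x : count a (take r (nseq n x)) = a x * minn r n.
Proof. by elim: n r => [|n IH] [|r] //=; rewrite ?IH ?muln0 // minnSS mulnS. Qed.

(** Ordering the vertices by their keys gives runs of alternating colours, the run of key k
    having length pell (k - 1) + pell k, so that the excess of the last colour over the other
    one after the run of key k is pell k.  Along the natural numbers, the vertices of both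
    colours have to appear as early as they are needed to keep both excesses equal: key i + 2
    alone while the excess is constant, then keys i + 2 and i + 1 alternately while both
    excesses increase from pell i to pell (i + 1). *)
Definition period i := nseq (pell i + pell i.+1) i.+2 ++ alternating (pell i.+1 - pell i) i.+2 i.+1.

Lemma size_period i : size (period i) = pell i + pell i.+1 + 2 * (pell i.+1 - pell i).
Proof. by rewrite size_cat size_nseq size_alternating. Qed.

Definition periods k := flatten [seq period i | i <- iota 0 k].

Lemma periodsS k : periods k.+1 = periods k ++ period k.
Proof. by rewrite /periods -addn1 iotaD map_cat flatten_cat /= cats0. Qed.

Lemma leq_size_periods k : k <= size (periods k).
Proof.
elim: k => // k IH; rewrite periodsS size_cat size_period.
have := pell_gt0 k; lia.
Qed.

Lemma periods_prefix k k' : k <= k' -> exists s, periods k' = periods k ++ s.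
Proof.
elim: k' => [|k' IH]; first by rewrite leqn0 => /eqP ->; exists [::]; rewrite cats0.
rewrite leq_eqVlt => /orP[/eqP ->|]; first by exists [::]; rewrite cats0.
by case/IH => s E; exists (s ++ period k'); rewrite periodsS E catA.
Qed.

Definition key v := nth 0 (periods v.+1) v.

Lemma keyE k v : v < size (periods k) -> key v = nth 0 (periods k) v.
Proof.
move=> vk; have v1 := leq_size_periods v.+1.
case: (leqP k v.+1) => [/periods_prefix[s E]|/ltnW/periods_prefix[s E]].
  by rewrite /key E nth_cat vk.
by rewrite /key E nth_cat v1.
Qed.

Lemma map_key k n : n <= size (periods k) -> [seq key v | v <- iota 0 n] = take n (periods k).
Proof.
move=> nk; apply: (@eq_from_nth _ 0); first by rewrite size_map size_iota size_takel.
move=> v; rewrite size_map size_iota => vn.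
by rewrite (nth_map 0) ?size_iota // nth_iota // nth_take // add0n (@keyE k) // (leq_trans vn).
Qed.

Lemma count_period (a : pred nat) i : count a (period i) =
  a i.+2 * (2 * pell i.+1) + a i.+1 * (pell i.+1 - pell i).
Proof.
rewrite count_cat count_nseq.
have -> : count a (alternating (pell i.+1 - pell i) i.+2 i.+1) =
    (a i.+2 + a i.+1) * (pell i.+1 - pell i).
  elim: (_ - _) => [|m IH]; first by rewrite muln0.
  by rewrite /alternating /= -/(alternating m _ _) IH; lia.
by have := leq_pell i; case: (a i.+2); case: (a i.+1); lia.
Qed.

Fixpoint pell_sum n := if n is n'.+1 then pell_sum n' + pell n else 0.

Lemma pell_sumE n : 2 * pell_sum n + 1 = pell n + pell n.+1.
Proof. by elim: n => // n /=; rewrite pellSS; lia. Qed.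

Lemma count_periods i :
  count (fun k => odd k == odd i) (periods i) = pell_sum i /\
  count (fun k => odd k != odd i) (periods i) = pell_sum i + pell i.
Proof.
elim: i => [|i [h1 h2]]; first by split.
rewrite periodsS !(count_cat _ (periods i)) !count_period /= !negbK.
have -> : count (fun k => odd k == ~~ odd i) (periods i) = pell_sum i + pell i.
  by rewrite -h2; apply: eq_count => k; case: (odd k); case: (odd i).
have -> : count (fun k => odd k != ~~ odd i) (periods i) = pell_sum i.
  by rewrite -h1; apply: eq_count => k; case: (odd k); case: (odd i).
by have := leq_pell i; case: (odd i); rewrite /=; lia.
Qed.

Lemma key_period i k : k \in period i -> k = i.+1 \/ k = i.+2.
Proof.
rewrite mem_cat => /orP[|/flattenP[s]]; first by rewrite mem_nseq => /andP[_ /eqP]; right.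
by rewrite mem_nseq => /andP[_ /eqP ->]; rewrite !inE => /orP[] /eqP; [right|left].
Qed.

Lemma leq_key_periods i k : k \in periods i -> k <= i.+1.
Proof.
elim: i => // i IH; rewrite periodsS mem_cat => /orP[/IH|/key_period]; lia.
Qed.

Lemma key_gt k v : size (periods k) <= v -> k < key v.
Proof.
move=> kv; pose k' := v.+1; have v1 := leq_size_periods v.+1.
suff : forall m, key v \in periods m -> v < size (periods m) -> k < key v.
  by apply; [apply: mem_nth|]; exact: v1.
move=> m _; elim: m => // m IH vm.
have [/IH //|vm'] := ltnP v (size (periods m)).
have km : k <= m.
  rewrite leqNgt; apply/negP => /periods_prefix[s E].
  by move: kv; rewrite E size_cat; lia.
have : key v \in period m.
  rewrite (keyE vm) periodsS nth_cat ltnNge vm' /=; apply: mem_nth.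
  by rewrite ltn_subLR // -size_cat -periodsS.
by case/key_period => ->; lia.
Qed.

(** Vertices are numbered from 1, the arguments of key from 0. *)
Definition key_colour m n := odd (minn (key m.-1) (key n.-1)).

Lemma key_colourC m n : key_colour m n = key_colour n m.
Proof. by rewrite /key_colour minnC. Qed.

(** V is the set of vertices of a copy of colour b, and g is an injection of V into itself
    along edges of the copy. *)
Section Monochromatic.
Variables (V : pred nat) (b : bool) (g : nat -> nat).
Hypothesis g_inj : {in V &, injective g}.
Hypothesis g_col : forall v, V v -> odd (minn (key v) (key (g v))) = b.

(** A vertex of V with a key of the wrong parity is sent by g to a vertex with a smaller key
    of the right parity.  Keys at most k + 1 of the parity of k only occur in the first k
    periods, where there are pell_sum k of them. *)
Lemma count_monochromatic n k : odd k = b ->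
  count V (iota 0 n) + count (fun v => (odd (key v) != b) && (key v <= k.+1)) (iota 0 n) <=
  n + pell_sum k.
Proof.
move=> kb; pose opp v := (odd (key v) != b) && (key v <= k.+1).
rewrite -/opp (_ : count V _ =
  count (predI V opp) (iota 0 n) + count (predI V (predC opp)) (iota 0 n)); last first.
  elim: (iota 0 n) => //= v s ->; by case: (V v); case: (opp v); lia.
have -> : n + pell_sum k = pell_sum k + (count opp (iota 0 n) + count (predC opp) (iota 0 n)).
  by rewrite count_predC size_iota addnC.
have h1 : count (predI V (predC opp)) (iota 0 n) <= count (predC opp) (iota 0 n).
  by apply: sub_count => v /andP[].
suff : count (predI V opp) (iota 0 n) <= pell_sum k by lia.
have [<- _] := count_periods k; rewrite -size_filter.
rewrite -[X in count _ X](take_size) -(@map_key k) // count_map -size_filter.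
rewrite -(size_map g); apply: uniq_leq_size.
  rewrite map_inj_in_uniq ?filter_uniq ?iota_uniq // => v w.
  by rewrite !mem_filter => /andP[/andP[Vv _] _] /andP[/andP[Vw _] _]; exact: g_inj.
move=> w /mapP[v]; rewrite mem_filter => /andP[/andP[Vv /andP[ov kv]] _] -> {w}.
have := g_col Vv; rewrite mem_filter mem_iota add0n /= /minn.
case: ltnP => h e; first by rewrite e eqxx in ov.
have kg : key (g v) < key v.
  by rewrite ltn_neqAle h andbT; apply: contra ov => /eqP <-; rewrite e.
rewrite e kb eqxx /= ltnNge; apply/negP => /key_gt; lia.
Qed.
End Monochromatic.

Lemma period_of n : exists i, size (periods i) <= n < size (periods i.+1).
Proof.
suff : forall k, n < size (periods k) -> exists i, size (periods i) <= n < size (periods i.+1).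
  by apply; exact: (leq_size_periods n.+1).
elim=> // i IH h; have [/IH //|h'] := ltnP n (size (periods i)).
by exists i; rewrite h' h.
Qed.

Lemma count_opp i n (b : bool) k : n <= size (periods i.+1) ->
  k = (if odd i == b then i.+1 else i.+2) ->
  count (fun v => (odd (key v) != b) && (key v <= k)) (iota 0 n) =
  count (fun k => odd k != b) (take n (periods i.+1)).
Proof.
move=> ni hk; rewrite -(map_key ni) count_map; apply: eq_in_count => v.
rewrite mem_iota add0n => vn /=; case: (boolP (odd (key v) == b)) => //= ov.
have : key v \in periods i.+1.
  by rewrite (keyE (leq_trans vn ni)); apply: mem_nth; exact: leq_trans ni.
move/leq_key_periods; rewrite hk; case: ifP => // /eqP ib.
rewrite leq_eqVlt => /predU1P[E|//].
by case/negP: ov; rewrite E /= negbK ib.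
Qed.

Lemma count_take_period (a : pred nat) i r : r <= size (period i) ->
  count a (take r (period i)) =
    a i.+2 * (minn r (pell i + pell i.+1) + uphalf (r - (pell i + pell i.+1))) +
    a i.+1 * (r - (pell i + pell i.+1))./2.
Proof.
rewrite size_period => hr; rewrite /period take_cat size_nseq.
case: ltnP => h.
  rewrite count_take_nseq (minn_idPl (ltnW h)).
  by rewrite (_ : r - _ = 0) ?muln0 ?addn0 //; apply/eqP; rewrite subn_eq0 ltnW.
by rewrite count_cat count_nseq count_take_alternating; case: (a i.+2); case: (a i.+1); lia.
Qed.

(** The excess pell i + j is attained for both colours.  For the parity of i the threshold is
    the key i + 1.  For the other parity it is i + 2 in the alternating part of the period,
    and i before, where the vertices of key i + 2 are still too few. *)
Lemma missing_vertices n : exists i j, n <= 2 * pell i.+1 + 3 * pell i + 2 * j /\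
  forall (V : pred nat) b (g : nat -> nat), {in V &, injective g} ->
    (forall v, V v -> odd (minn (key v) (key (g v))) = b) ->
    count V (iota 0 n) + (pell i + j) <= n.
Proof.
have [i /andP[in1 ni]] := period_of n.
pose a := pell i + pell i.+1; pose r := n - size (periods i).
have [c1 c2] := count_periods i.
have szi : size (periods i) = 2 * pell_sum i + pell i.
  rewrite -(count_predC (fun k => odd k == odd i)) c1.
  by rewrite [X in _ + X]c2; lia.
have rs : r <= size (period i).
  by rewrite leq_subLR -size_cat -periodsS ltnW.
have takeE : take n (periods i.+1) = periods i ++ take r (period i).
  by rewrite periodsS take_cat ltnNge in1.
exists i, (r - a)./2; split.
  have := pell_sumE i; rewrite /r /a szi; lia.
move=> V b g g_inj g_col.
have CM := count_monochromatic g_inj g_col n.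
have trivial_bound : count V (iota 0 n) <= n.
  by rewrite -[X in _ <= X](size_iota 0 n) count_size.
have [bi|bi] := eqVneq (odd i) b.
  have := CM i bi; rewrite (@count_opp i n b i.+1) ?(ltnW ni) ?bi ?eqxx //.
  rewrite takeE count_cat count_take_period //= -bi c2 negbK eqxx.
  by rewrite /a; case: (odd i) => /=; lia.
have {}bi : odd i.+1 = b by move: bi; rewrite /=; case: (odd i); case: (b).
have bE : forall k, (odd k != b) = (odd k == odd i).
  by move=> k; rewrite -bi /=; case: (odd i); case: (odd k).
have [ra|ra] := leqP r a.
  rewrite (_ : (r - a)./2 = 0); last by lia.
  move: c1 bi bE in1; clear -CM trivial_bound.
  case: i => [|i] c1 bi bE in1; first by rewrite (_ : pell 0 + 0 = 0) // addn0.
  have := CM i; rewrite -bi /= negbK => /(_ erefl).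
  have : pell_sum i.+1 <= count (fun v => (odd (key v) != odd i) && (key v <= i.+1)) (iota 0 n).
    rewrite -[n](subnKC in1) iotaD count_cat; apply: leq_trans (leq_addr _ _).
    rewrite (@count_opp i) ?eqxx // take_size -c1.
    by apply: sub_count => v /=; case: (odd v); case: (odd i).
  by rewrite /=; lia.
have := CM i.+1 bi; rewrite (@count_opp i n b i.+2) ?(ltnW ni) //; last first.
  by rewrite -bi /=; case: (odd i).
rewrite takeE count_cat count_take_period //= (eq_count bE) c1 -bi /= negbK.
by rewrite -/a !(minn_idPr (ltnW ra)); case: (odd i) => /=; lia.
Qed.

Local Open Scope ring_scope.

(** * Zigzag sequences *)

Section ZigzagBound.
Variable R : realType.

(** These are the properties of the times a n and b n at which a 1-Lipschitz function that
    starts at 0 reaches the heights n and - n for the first time: reaching a greater height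
    takes longer by at least the difference, and passing from height n to height - m takes
    at least the time n + m. *)
Record zigzag (lo hi : nat) (a b : nat -> R) : Prop := Zigzag {
  zigzag_ge0 : forall n, (lo <= n <= hi)%N -> 0 <= a n /\ 0 <= b n;
  zigzag_growl : forall n m, (lo <= n)%N -> (n <= m)%N -> (m <= hi)%N ->
    a n + (m%:R - n%:R) <= a m;
  zigzag_growr : forall n m, (lo <= n)%N -> (n <= m)%N -> (m <= hi)%N ->
    b n + (m%:R - n%:R) <= b m;
  zigzag_sep : forall n m, (lo <= n <= hi)%N -> (lo <= m <= hi)%N ->
    n%:R + m%:R <= `|a n - b m| }.

Lemma zigzagC lo hi a b : zigzag lo hi a b -> zigzag lo hi b a.
Proof.
case=> p ga gb s; split=> // [n /p[]|n m hn hm] //.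
by rewrite distrC addrC; exact: s.
Qed.

(** The height u is the greatest one reached by a before time b t, and y - u is the time at
    which it is reached.  As b t is at least y + t, the sum a t + b t is at least
    z + y + 2 t, and both heights u + 1 and - (u + 1) are reached only after a return through
    height 0, at time y or later. *)
Lemma zigzag_next_peak lo hi a b K t z : zigzag lo hi a b ->
  (forall n, (lo <= n <= hi)%N -> a n + b n <= K * n%:R) ->
  (lo <= t)%N -> K * t%:R < hi%:R -> 0 <= K -> (0 < t)%N ->
  z + t%:R <= a t -> a t <= b t -> (t <= hi)%N ->
  exists u y, [/\ (t <= u)%N, u.+1%:R <= K * t%:R, z + u%:R *+ 2 <= y &
    [/\ z + y + t%:R *+ 2 <= K * t%:R,
       y + u.+1%:R <= a u.+1 & y + u.+1%:R <= b u.+1]].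
Proof.
move=> zz bnd lt Kt K0 t0 za ab thi.
have [p ga gb s] := zz.
pose P u := (t <= u <= hi)%N && (a u <= b t).
have exP : exists u, P u by exists t; rewrite /P leqnn thi ab.
have ubP u : P u -> (u <= hi)%N by case/andP => /andP[].
case: (ex_maxnP exP ubP) => u /andP[/andP[tu uhi] aub] umax.
have lu : (lo <= u)%N by lia.
have H1 : u%:R + t%:R <= b t - a u.
  have := s u t; rewrite lu uhi lt thi => /(_ isT isT).
  by rewrite ler0_norm; lra.
have [pt ptb] : 0 <= a t /\ 0 <= b t by apply: p; rewrite lt thi.
have [pu _] : 0 <= a u /\ 0 <= b u by apply: p; rewrite lu uhi.
have Bt : a t + b t <= K * t%:R by apply: bnd; rewrite lt thi.
have t1 : 1 <= t%:R :> R by rewrite ler1n.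
have uK : u%:R + 1 <= K * t%:R by lra.
have uhi1 : (u < hi)%N.
  by rewrite -(ltr_nat R); lra.
have gat := ga t u lt tu uhi.
have au1 : b t < a u.+1.
  rewrite ltNge; apply/negP => h.
  by have := umax u.+1; rewrite /P h uhi1 andbT ltnn (leq_trans tu) // => /(_ isT).
have S1 : u.+1%:R + t%:R <= a u.+1 - b t.
  have := s u.+1 t; rewrite (leq_trans lu) // uhi1 lt thi => /(_ isT isT).
  by rewrite gtr0_norm; lra.
have gbt := gb t u.+1 lt (leqW tu) uhi1.
have tu' : t%:R <= u%:R :> R by rewrite ler_nat.
have S2 : u%:R + u.+1%:R <= b u.+1 - a u.
  have := s u u.+1; rewrite lu uhi (leq_trans lu) // uhi1 => /(_ isT isT).
  rewrite ler0_norm; first by lra.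
  by move: gbt; rewrite -natr1; lra.
exists u, (a u + u%:R); split=> //; rewrite -?natr1 in S1 S2 gbt *; try lra.
by split; lra.
Qed.

(** Iterating this step, the successive values z, y, ... satisfy
    y' + y <= 2 c (u + 1) and 2 u <= y - z with K = 2 c + 2, hence
    y' <= (c - 1) y - c z + 2 c. *)
Lemma zigzag_step lo hi a b K t z : zigzag lo hi a b ->
  (forall n, (lo <= n <= hi)%N -> a n + b n <= K * n%:R) ->
  (lo <= t)%N -> K * t%:R < hi%:R -> 1 <= K -> (0 < t)%N ->
  z + t%:R <= a t -> z + t%:R <= b t ->
  exists u y, [/\ (t <= u)%N, u.+1%:R <= K * t%:R, z + u%:R *+ 2 <= y &
    [/\ z + y + t%:R *+ 2 <= K * t%:R,
       y + u.+1%:R <= a u.+1 & y + u.+1%:R <= b u.+1]].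
Proof.
move=> zz bnd lt Kt K1 t0 za zb.
have thi : (t <= hi)%N.
  rewrite -(ler_nat R); apply/ltW/(le_lt_trans _ Kt).
  by rewrite ler_peMl.
case: (leP (a t) (b t)) => ab.
  exact: (zigzag_next_peak zz bnd lt Kt (le_trans ler01 K1) t0 za ab thi).
have bnd' n : (lo <= n <= hi)%N -> b n + a n <= K * n%:R.
  by move=> /bnd; rewrite addrC.
have [u [y [h1 h2 h3 [h4 h5 h6]]]] :=
  zigzag_next_peak (zigzagC zz) bnd' lt Kt (le_trans ler01 K1) t0 zb (ltW ab) thi.
by exists u, y.
Qed.

(** The ratio r of consecutive values of z is replaced at each step by at most
    c - 1 + eta - c / r, where eta absorbs the rounding error 2 c.  If this map decreases r
    by kap each time, then r becomes negative after k steps. *)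
Lemma zigzag_ratio_descent lo hi a b (c eta r0 kap : R) (B k : nat) :
  zigzag lo hi a b ->
  (forall n, (lo <= n <= hi)%N -> a n + b n <= (c *+ 2 + 2) * n%:R) ->
  0 < c -> c *+ 2 + 2 <= B%:R -> 0 < r0 -> 0 < kap ->
  (forall r, 0 < r -> r <= r0 -> c - 1 + eta - c / r <= r - kap) ->
  forall (t : nat) (w z r : R), (lo <= t)%N -> (0 < t)%N ->
  (t * B ^ k.+1 < hi)%N ->
  0 < w -> w <= z -> c *+ 2 <= eta * z -> 0 < eta ->
  z <= r * w -> 0 < r -> r <= r0 -> r <= k%:R * kap ->
  z + t%:R <= a t -> z + t%:R <= b t -> (t%:R - 1) *+ 2 <= z - w -> False.
Proof.
move=> zz bnd c0 cB r00 kap0 step.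
elim: k => [|k IH] t w z r lt t0 thi w0 wz ez eta0 zr r1 rr0 rk za zb tz.
  by rewrite mul0r in rk; lra.
have Bt : (c *+ 2 + 2) * t%:R < hi%:R.
  have B0 : (0 < B)%N by rewrite -(ltr_nat R); lra.
  have : (t * B <= t * B ^ k.+2)%N.
    by rewrite leq_mul2l -[X in (X <= _)%N]expn1 leq_pexp2l ?orbT.
  move/leq_ltn_trans/(_ thi); rewrite -(ltr_nat R) natrM; apply: le_lt_trans.
  by rewrite mulrC ler_wpM2l.
have [|u [y [tu uB zy [zyt ya yb]]]] := zigzag_step zz bnd lt Bt _ t0 za zb; first by lra.
have z0 : 0 < z by lra.
have u0 : 0 <= u%:R :> R by [].
have yz : z <= y by lra.
have E1 : y <= (c - 1 + eta - c / r) * z.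
  have E2 : y + z <= c * (z - w) + c *+ 2.
    have : c * ((t%:R - 1) *+ 2) <= c * (z - w) by rewrite ler_pM2l.
    by lra.
  have E3 : c / r * z <= c * w.
    by rewrite -mulrA ler_pM2l // mulrC ler_pdivrMr // mulrC.
  by lra.
have sr := step r r1 rr0.
have r'0 : 0 < c - 1 + eta - c / r.
  rewrite ltNge; apply/negP => h.
  have : 0 <= - (c - 1 + eta - c / r) * z by rewrite mulr_ge0 // ?oppr_ge0 // ltW.
  lra.
have tz' : (u.+1%:R - 1) *+ 2 <= y - z by rewrite -natr1; clear -zy; lra.
apply: (IH u.+1 z y (c - 1 + eta - c / r)) => //.
- exact: leq_trans lt (leqW tu).
- have uB' : (u.+1 <= B * t)%N.
    rewrite -(ler_nat R) natrM; apply: (le_trans uB).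
    by rewrite ler_wpM2r.
  apply: leq_ltn_trans thi.
  by rewrite (expnS _ k.+1) mulnA (mulnC t) leq_mul2r uB' orbT.
- by apply: (le_trans ez); rewrite ler_pM2l.
- by apply: (le_trans sr); rewrite lerBlDr (le_trans rr0) // lerDl ltW.
- by move: rk sr; rewrite -[k.+1%:R]natr1; clear; lra.
Qed.

(** The equation r = c - 1 - c / r has the discriminant c^2 - 6 c + 1, which is negative
    exactly for c between 3 - 2 sqrt 2 and 3 + 2 sqrt 2. *)
Lemma quadratic_descent (c : R) : 2 <= c -> c < 3 + Num.sqrt 2 *+ 2 ->
  exists eta kap : R, [/\ 0 < eta, 0 < kap &
    forall r, 0 < r -> r <= 4 * c -> c - 1 + eta - c / r <= r - kap].
Proof.
move=> c2 cq.
have s2 : 0 <= Num.sqrt 2 :> R by rewrite sqrtr_ge0.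
have s22 : Num.sqrt 2 * Num.sqrt 2 = 2 :> R by rewrite -expr2 sqr_sqrtr.
pose D := 6 * c - c * c - 1.
have D0 : 0 < D.
  have : 0 < (3 + Num.sqrt 2 *+ 2 - c) * (c - 3 + Num.sqrt 2 *+ 2).
    have s1 : 1 <= Num.sqrt 2 :> R by rewrite -[X in X <= _]sqrtr1 ler_wsqrtr // ler1n.
    by apply: mulr_gt0; lra.
  suff -> : (3 + Num.sqrt 2 *+ 2 - c) * (c - 3 + Num.sqrt 2 *+ 2) = D by [].
  rewrite /D; clear -s22; move: (Num.sqrt 2) s22 => s h.
  have -> : (3 + s *+ 2 - c) * (c - 3 + s *+ 2) =
    6 * c - c * c - 9 + 4 * (s * s) by ring.
  by rewrite h; ring.
clear cq s2 s22.
pose eta := D / (4 * c + D).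
have cD0 : 0 < 4 * c + D by lra.
have eta0 : 0 < eta by rewrite divr_gt0.
have etaE : eta * (4 * c + D) = D by rewrite /eta divfK ?gt_eqF.
have eta1 : eta < 1 by rewrite ltr_pdivrMr // mul1r; lra.
pose r0 := 4 * c.
have r00 : 0 < r0 by rewrite /r0; lra.
pose kap := D / 8 / r0.
have kap0 : 0 < kap by rewrite !divr_gt0.
have P2 : (c - 1 + eta) ^+ 2 / 4 <= c - D / 8.
  have : eta * (2 * c) * 2 <= D.
    have : 0 <= eta * D by rewrite mulr_ge0 ?ltW.
    by move: etaE; rewrite mulrDr; lra.
  have : eta * eta <= eta by rewrite ger_pMr // ltW.
  have -> : (c - 1 + eta) ^+ 2 / 4 =
     (c * c - 2 * c + 1) / 4 + (eta * (2 * c) - 2 * eta + eta * eta) / 4 by field.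
  by rewrite /D; lra.
have step r : 0 < r -> r <= r0 -> c - 1 + eta - c / r <= r - kap.
  move=> r1 rr0.
  suff : kap * r <= r * r - (c - 1 + eta) * r + c.
    move=> h; rewrite -(ler_pM2r r1).
    have -> : (c - 1 + eta - c / r) * r = (c - 1 + eta) * r - c.
      by rewrite mulrBl divfK // gt_eqF.
    by lra.
  have kr : kap * r <= D / 8.
    by rewrite /kap -mulrA ger_pMr ?divr_gt0 // mulrC ler_pdivrMr // mul1r.
  have : 0 <= (r - (c - 1 + eta) / 2) ^+ 2 by rewrite sqr_ge0.
  have -> : (r - (c - 1 + eta) / 2) ^+ 2 =
    r * r - (c - 1 + eta) * r + (c - 1 + eta) ^+ 2 / 4 by field.
  by lra.
by exists eta, kap.
Qed.

(** The constant 8 + 4 sqrt 2 is 2 c + 2 for the critical c = 3 + 2 sqrt 2. *)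
Lemma zigzag_slow (K : R) : K < 8 + 4 * Num.sqrt 2 ->
  exists C n0 : nat, (0 < C)%N /\ forall lo a b, (n0 <= lo)%N ->
    zigzag lo (C * lo) a b ->
    exists2 n, (lo <= n <= C * lo)%N & K * n%:R < a n + b n.
Proof.
move=> K8.
pose c : R := Num.max ((K - 2) / 2) 2.
have s2 : 0 <= Num.sqrt 2 :> R by rewrite sqrtr_ge0.
have c2 : 2 <= c by rewrite le_max lexx orbT.
have Kc : K <= c *+ 2 + 2.
  have : (K - 2) / 2 <= c by rewrite le_max lexx.
  by lra.
have cq : c < 3 + Num.sqrt 2 *+ 2 by rewrite gt_max; apply/andP; split; lra.
have [eta [kap [eta0 kap0 step]]] := quadratic_descent c2 cq.
clearbody c; clear K8 cq s2; pose r0 := 4 * c.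
have r00 : 0 < r0 by rewrite mulr_gt0 // (lt_le_trans _ c2).
pose B := Num.bound (c *+ 2 + 2).
have cB : c *+ 2 + 2 <= B%:R.
  by apply/ltW/archi_boundP; lra.
pose k := Num.bound (r0 / kap).
have rk : r0 <= k%:R * kap.
  rewrite -ler_pdivrMr //.
  by apply: ltW; apply: archi_boundP; rewrite divr_ge0 // ltW.
pose n0 := (Num.bound (c *+ 2 / eta)).+1.
exists (B ^ k.+3).+1, n0; split=> // lo a b lon zz.
apply: contrapT => nex.
have bnd n : (lo <= n <= (B ^ k.+3).+1 * lo)%N -> a n + b n <= (c *+ 2 + 2) * n%:R.
  move=> hn; rewrite leNgt; apply/negP => h; apply: nex; exists n => //.
  by apply: le_lt_trans h; rewrite ler_wpM2r.
have lo0 : (0 < lo)%N by apply: leq_trans lon.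
have lo1 : 1 <= lo%:R :> R by rewrite ler1n.
have B1 : (0 < B)%N by rewrite -(ltr_nat R); lra.
have hiE i t : (i <= k.+2)%N -> (t <= B ^ i * lo)%N ->
    (c *+ 2 + 2) * t%:R < ((B ^ k.+3).+1 * lo)%:R.
  move=> ik tB.
  have : (B * t < (B ^ k.+3).+1 * lo)%N.
    rewrite mulSn addnC -addn1 leq_add //.
    apply: leq_trans (_ : B * (B ^ i * lo) <= _)%N; first by rewrite leq_mul2l tB orbT.
    by rewrite mulnA -expnS leq_mul2r leq_pexp2l // orbT.
  rewrite -(ltr_nat R) natrM; apply: le_lt_trans.
  by rewrite ler_wpM2r.
have tB i t u : (t <= B ^ i * lo)%N -> u.+1%:R <= (c *+ 2 + 2) * t%:R ->
    (u.+1 <= B ^ i.+1 * lo)%N.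
  move=> tB uc; apply: leq_trans (_ : B * t <= _)%N.
    by rewrite -(ler_nat R) natrM (le_trans uc) // ler_wpM2r.
  by rewrite expnS -mulnA leq_mul2l tB orbT.
have lohi : (lo <= lo <= (B ^ k.+3).+1 * lo)%N by rewrite leqnn mulSn leq_addr.
have [pa pb] : 0 <= a lo /\ 0 <= b lo by case: zz => p _ _ _; apply: p.
have c1 : 1 <= c *+ 2 + 2 by lra.
have t0B : (lo <= B ^ 0 * lo)%N by rewrite mul1n.
have [||u0 [z1 [lu0 uK0 z01 [zz0 ya1 yb1]]]] :=
  @zigzag_step _ _ _ _ _ _ (- lo%:R) zz bnd (leqnn lo) (hiE 0%N _ isT t0B) c1 lo0.
- by rewrite addNr.
- by rewrite addNr.
have t1B := tB _ _ _ t0B uK0.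
have lu1 : (lo <= u0.+1)%N by rewrite leqW.
have [u1 [z2 [lu2 uK1 z12 [zz1 ya2 yb2]]]] :=
  zigzag_step zz bnd lu1 (hiE 1%N _ isT t1B) c1 (ltn0Sn _) ya1 yb1.
have t2B := tB _ _ _ t1B uK1.
have u0R : lo%:R <= u0%:R :> R by rewrite ler_nat.
have u1R : u0.+1%:R <= u1%:R :> R by rewrite ler_nat.
rewrite -natr1 in u1R.
have ez : c *+ 2 <= eta * z2.
  have h : c *+ 2 / eta <= lo%:R.
    have /(_ _)/ltW := archi_boundP (_ : 0 <= c *+ 2 / eta).
    rewrite divr_ge0 ?mulrn_wge0 ?(ltW eta0) ?(le_trans _ c2) // => /(_ isT) h.
    apply: (le_trans h); rewrite ler_nat; exact: leq_trans (leqnSn _) lon.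
  rewrite mulrC -ler_pdivrMr //; clear -h z12 z01 u0R u1R lo1; lra.
apply: (zigzag_ratio_descent zz bnd _ cB r00 kap0 step (w := z1) (z := z2)
  (r := r0) (k := k) (t := u1.+1) (eta := eta)) => //.
- by clear -c2; lra.
- by rewrite (leq_trans lu1) // leqW.
- apply: (@leq_ltn_trans (B ^ k.+3 * lo)); last by rewrite ltn_mul2r lo0 ltnSn.
  rewrite (_ : k.+3 = 2 + k.+1)%N // expnD mulnAC leq_mul2r.
  by rewrite t2B orbT.
- by clear -z01 u0R lo1; lra.
- by clear -z12 u1R u0R lo1; lra.
- have : 0 <= c * (2 * z1 - (u0%:R + 1)) by rewrite mulr_ge0 //; clear -c2 z01 u0R lo1; lra.
  by move: zz1; rewrite -natr1 /r0; clear -z01 u0R lo1; lra.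
- by rewrite -[u1.+1%:R]natr1; clear -z12; lra.
Qed.
End ZigzagBound.

(** * Deficient sets of both colours cannot coexist *)

(** Replacing a sequence by its tail minima makes it monotone, as required of a zigzag, and
    keeps all upper bounds; each of its values still comes from a later index. *)
Definition tail_min (N : nat) (x : nat -> nat) (n : nat) : nat :=
  \big[minn/x N]_(n <= m < N) x m.

Lemma tail_minS N x n : (n < N)%N -> tail_min N x n = minn (x n) (tail_min N x n.+1).
Proof. by move=> nN; rewrite /tail_min big_ltn. Qed.

Lemma tail_min_le N x n m : (n <= m <= N)%N -> (tail_min N x n <= tail_min N x m)%N.
Proof.
case/andP => nm mN; elim: m nm mN => [|m IH].
  by rewrite leqn0 => /eqP ->.
rewrite leq_eqVlt => /orP[/eqP -> //|nm mN].
apply: leq_trans (IH nm (ltnW mN)) _.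
by rewrite (tail_minS _ mN) geq_minr.
Qed.

Lemma tail_min_attained N x n : (n <= N)%N ->
  exists2 m, (n <= m <= N)%N & tail_min N x n = x m.
Proof.
move=> nN; move: {2}(N - n)%N (erefl (N - n)%N) => k.
elim: k n nN => [|k IH] n nN E.
  by exists N; [lia|rewrite /tail_min big_geq //; lia].
have nN' : (n < N)%N by lia.
have [|m hm Em] := IH n.+1 nN'; first by lia.
rewrite tail_minS //; case: (leqP (x n) (tail_min N x n.+1)) => h.
  by exists n => //; rewrite leqnn.
by exists m => //; lia.
Qed.

Lemma tail_min_self N x n : (n <= N)%N -> (tail_min N x n <= x n)%N.
Proof.
rewrite leq_eqVlt => /orP[/eqP ->|nN]; first by rewrite /tail_min big_geq.
by rewrite tail_minS // geq_minl.
Qed.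

Section Deficiency.
Variable R : realType.

(** With x and y made monotone, the sequences a n = 2 x n / d + n and b n = 2 y n / d + n form a
    zigzag: if s m <= x n + eps, say, then x n - y m is at least d m, so that a n - b m is at
    least n + m.  But x n + y n <= n - 2 d' n, whence a n + b n <= (2 / d - 2) n, and the
    factor 2 / d - 2 is less than 8 + 4 sqrt 2. *)
Lemma double_deficiency (d d' : R) : (5 + 2 * Num.sqrt 2)^-1 < d -> d < d' ->
  exists C lo0 : nat, (0 < C)%N /\ forall lo (x t y s : nat -> nat) (eps : R),
   (lo0 <= lo)%N -> eps <= (d' - d) * lo%:R ->
   (forall n, (lo <= n <= C * lo)%N ->
     [/\ d' * n%:R <= (t n)%:R - (x n)%:R, d' * n%:R <= (s n)%:R - (y n)%:R
       & (t n + s n <= n)%N]) ->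
   (forall n m, (lo <= n <= C * lo)%N -> (lo <= m <= C * lo)%N ->
     (s m)%:R <= (x n)%:R + eps \/ (t n)%:R <= (y m)%:R + eps) -> False.
Proof.
move=> dlt dd'.
have s2 : 0 <= Num.sqrt 2 :> R by rewrite sqrtr_ge0.
have s22 : Num.sqrt 2 * Num.sqrt 2 = 2 :> R by rewrite -expr2 sqr_sqrtr.
have d0 : 0 < d by apply: lt_trans dlt; rewrite invr_gt0; lra.
have K8 : 2 / d - 2 < 8 + 4 * Num.sqrt 2.
  rewrite ltrBlDr -ltr_pdivlMr ?invr_gt0 // invrK.
  by move: dlt; rewrite -[_^-1]div1r ltr_pdivrMr; lra.
have [C [lo0 [C0 H]]] := zigzag_slow K8.
exists C, lo0; split=> // lo x t y s eps lolo epsd hts cmp.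
set N := (C * lo)%N in hts cmp.
pose a n : R := 2 * (tail_min N x n)%:R / d + n%:R.
pose b n : R := 2 * (tail_min N y n)%:R / d + n%:R.
have zz : zigzag lo N a b.
  split.
  - by move=> n _; split; rewrite addr_ge0 // divr_ge0 ?mulr_ge0 // ltW.
  - move=> n m ln nm mN; rewrite /a.
    have : 2 * (tail_min N x n)%:R / d <= 2 * (tail_min N x m)%:R / d.
      by rewrite ler_pM2r ?invr_gt0 // ler_pM2l // ler_nat tail_min_le // nm.
    lra.
  - move=> n m ln nm mN; rewrite /b.
    have : 2 * (tail_min N y n)%:R / d <= 2 * (tail_min N y m)%:R / d.
      by rewrite ler_pM2r ?invr_gt0 // ler_pM2l // ler_nat tail_min_le // nm.
    lra.
  - move=> n m /andP[ln nN] /andP[lm mN].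
    have [n' /andP[nn' n'N] En] := tail_min_attained x nN.
    have [m' /andP[mm' m'N] Em] := tail_min_attained y mN.
    rewrite /a /b En Em.
    have hn' : (lo <= n' <= N)%N by rewrite (leq_trans ln nn').
    have hm' : (lo <= m' <= N)%N by rewrite (leq_trans lm mm').
    have [tn _ _] := hts _ hn'; have [_ sm _] := hts _ hm'.
    have nR : n%:R <= n'%:R :> R by rewrite ler_nat.
    have mR : m%:R <= m'%:R :> R by rewrite ler_nat.
    have lnR : lo%:R <= n%:R :> R by rewrite ler_nat.
    have lmR : lo%:R <= m%:R :> R by rewrite ler_nat.
    have d'n : d' * n%:R <= d' * n'%:R by rewrite ler_pM2l //; lra.
    have d'm : d' * m%:R <= d' * m'%:R by rewrite ler_pM2l //; lra.
    have en : (d' - d) * lo%:R <= (d' - d) * n%:R by rewrite ler_pM2l //; lra.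
    have em : (d' - d) * lo%:R <= (d' - d) * m%:R by rewrite ler_pM2l //; lra.
    have [h|h] := cmp _ _ hn' hm'.
      have : d * m%:R <= (x n')%:R - (y m')%:R by lra.
      rewrite mulrC -ler_pdivlMr // => h'.
      by apply: (le_trans _ (ler_norm _)); rewrite mulrBl in h'; lra.
    have : d * n%:R <= (y m')%:R - (x n')%:R by lra.
    rewrite mulrC -ler_pdivlMr // => h'.
    by rewrite distrC; apply: (le_trans _ (ler_norm _)); rewrite mulrBl in h'; lra.
have [n /andP[ln nN]] := H lo a b lolo zz.
have [tn sn tsn] := hts n (introT andP (conj ln nN)).
apply/negP; rewrite -leNgt /a /b.
have xn : (tail_min N x n)%:R <= (x n)%:R :> R by rewrite ler_nat tail_min_self.
have yn : (tail_min N y n)%:R <= (y n)%:R :> R by rewrite ler_nat tail_min_self.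
have {}tsn : (t n)%:R + (s n)%:R <= n%:R :> R by rewrite -natrD ler_nat.
have dn : d * n%:R <= d' * n%:R by rewrite ler_wpM2r // ltW.
have : (tail_min N x n)%:R + (tail_min N y n)%:R + 2 * (d * n%:R) <= n%:R by lra.
rewrite -(ler_pM2r (_ : 0 < 2 / d)) ?divr_gt0 // mulrDl.
have -> : 2 * (d * n%:R) * (2 / d) = 4 * n%:R by field; rewrite gt_eqF.
have -> : (2 / d - 2) * n%:R = n%:R * (2 / d) - 2 * n%:R by ring.
rewrite mulrDl.
set u := (tail_min N x n)%:R; set v := (tail_min N y n)%:R.
have -> : u * (2 / d) = 2 * u / d by ring.
have -> : v * (2 / d) = 2 * v / d by ring.
lra.
Qed.
End Deficiency.

(** * Monochromatic blocks in finite colourings *)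

Section Core.
Variables (N : nat) (e : 'I_N -> 'I_N -> bool) (chi : 'I_N -> bool).
Hypothesis e_sym : forall x y, e x y = e y x.

Definition colour_class kappa : {set 'I_N} := [set x | chi x == kappa]%SET.
(** Ordinals below N stand for the vertices, and n for the initial segment in which the
    density is measured. *)
Definition low_class kappa n : {set 'I_N} := [set x | (chi x == kappa) && (x < n)%N]%SET.

Lemma low_classS kappa n : low_class kappa n \subset colour_class kappa.
Proof. by apply/subsetP => x; rewrite !inE => /andP[]. Qed.

Lemma card_low_class kappa n : (n <= N)%N ->
  (#|low_class kappa n| + #|low_class (~~ kappa) n| = n)%N.
Proof.
move=> nN; pose S := [set x : 'I_N | (x < n)%N]%SET.
have -> : low_class kappa n = [set x in S | chi x == kappa]%SET.
  by apply/setP => x; rewrite !inE andbC.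
have -> : low_class (~~ kappa) n = S :\: [set x in S | chi x == kappa]%SET.
  apply/setP => x; rewrite !inE; case: (x < n)%N; rewrite ?andbF ?andbT //.
  by case: (chi x); case: kappa.
rewrite cardsDS; last by apply/subsetP => x; rewrite inE => /andP[].
rewrite subnKC; last by apply: subset_leq_card; apply/subsetP => x; rewrite inE => /andP[].
have -> : S = [set widen_ord nN i | i in [set: 'I_n]]%SET.
  apply/setP => x; rewrite inE; apply/idP/imsetP => [xn|[i _ ->] /=]; last exact: ltn_ord.
  by exists (Ordinal xn) => //; apply: val_inj.
rewrite card_imset ?cardsT ?card_ord //.
by move=> i j /(congr1 val) /= /val_inj.
Qed.

Lemma blockC s kappa X Y : block e s kappa X Y = block e s kappa Y X.
Proof.
rewrite /block andbCA; congr [&& _, _ & _].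
apply/forall_inP/forall_inP => h x xX; apply/forall_inP => y yY.
  by rewrite e_sym; exact: (forall_inP (h y yY)).
by rewrite e_sym; exact: (forall_inP (h y yY)).
Qed.

Variables (s q : nat) (L : finType) (lab : 'I_N -> L).
Hypotheses (s0 : (0 < s)%N) (q0 : (0 < q)%N).

(** In colour kappa, the vertices outside the class kappa are to be matched into the class
    kappa.  So the pair is oriented from the cell of the class ~~ kappa to that of the class
    kappa, whereas full takes the cell of the class true first. *)
Definition full_to kappa i j :=
  if kappa then full e s (colour_class true) (colour_class false) q lab true j i
  else full e s (colour_class true) (colour_class false) q lab false i j.

Definition full_edge kappa (x y : 'I_N) := (y \in colour_class kappa) && full_to kappa (lab x) (lab y).

Lemma full_to_block kappa i j (X Y : {set 'I_N}) : full_to kappa i j ->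
  X \subset cell lab (colour_class (~~ kappa)) i -> Y \subset cell lab (colour_class kappa) j ->
  (#|cell lab (colour_class (~~ kappa)) i| <= q * #|X|)%N ->
  (#|cell lab (colour_class kappa) j| <= q * #|Y|)%N ->
  exists X' Y' : {set 'I_N}, [/\ X' \subset X, Y' \subset Y & block e s kappa X' Y'].
Proof.
rewrite /full_to; case: kappa => /= /forallP h hX hY cX cY.
  have /forallP/(_ X)/implyP := h Y; rewrite hX hY cX cY => /(_ isT)/has_blockP.
  by move=> [Y' [X' [h1 h2 h3]]]; exists X', Y'; rewrite blockC.
have /forallP/(_ Y)/implyP := h X; rewrite hX hY cX cY => /(_ isT)/has_blockP.
by move=> [X' [Y' [h1 h2 h3]]]; exists X', Y'.
Qed.

(** Hall's alternative for the pairs of full cells. *)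
Lemma blocks_or_deficiency kappa n D : (0 < n)%N -> (n <= N)%N ->
  (exists2 F, block_family (block e s kappa) (low_class (~~ kappa) n) (colour_class kappa) F &
     (q * n <= q * (#|low_class kappa n| + s * size F + D) +
        q * (s * (#|L| * #|L|) + 2 * #|L|) + N)%N) \/
  exists2 S : {set 'I_N}, S \subset low_class (~~ kappa) n & (#|nbhd (full_edge kappa) S| + D < #|S|)%N.
Proof.
move=> n0 nN.
have [/exists_inP[S]|nS] := boolP [exists S : {set 'I_N} in powerset (low_class (~~ kappa) n),
    (#|nbhd (full_edge kappa) S| + D < #|S|)%N].
  by rewrite inE => h1 h2; right; exists S.
left.
have [|M [f [MA cM sat]]] := @hall_deficiency _ _ (full_edge kappa)
  (low_class (~~ kappa) n) D (Ordinal (leq_trans n0 nN)).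
  move=> S hS; rewrite leqNgt; apply/negP => h; case/negP: nS.
  by apply/exists_inP; exists S => //; rewrite inE.
have [||F fF hF] := blocks_of_matching s0 q0 _ _ (low_classS (~~ kappa) n) MA sat (blkp := block e s kappa).
- by move=> X Y /and3P[/eqP -> /eqP ->].
- by move=> i j ij X Y; apply: full_to_block.
exists F => //.
have cn := card_low_class kappa nN.
have dj : (#|colour_class (~~ kappa)| + #|colour_class kappa| <= N)%N.
  rewrite -[N in X in (_ <= X)%N]card_ord -(cardsC (colour_class kappa)) addnC leq_add2l.
  by apply: subset_leq_card; apply/subsetP => x; rewrite !inE; case: (chi x); case: (kappa).
have : (q * n <= q * #|low_class kappa n| + (q * #|M| + q * D))%N.
  by rewrite -!mulnDr leq_mul2l -[X in (X <= _)%N]cn leq_add2l cM orbT.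
move=> h; apply: (leq_trans h); rewrite (mulnDr q (_ + _)%N D) (mulnDr q _ (s * size F)%N).
have hM := leq_trans hF (leq_add (leqnn _) dj).
rewrite -!addnA leq_add2l; apply: leq_trans (leq_add hM (leqnn _)) _.
by rewrite -!addnA leq_add2l [X in (_ <= X)%N]addnC -addnA.
Qed.

(** Such a pair is not full in colour true, since x is not a neighbour of S1, and not full in
    colour false, since y is not a neighbour of S2. *)
Lemma irregular_product (S1 : {set 'I_N}) n1 (S2 : {set 'I_N}) n2 :
  S1 \subset low_class false n1 -> S2 \subset low_class true n2 ->
  (#|S2 :\: nbhd (full_edge true) S1| * #|S1 :\: nbhd (full_edge false) S2| <=
   #|irregular e s (colour_class true) (colour_class false) q lab|)%N.
Proof.
move=> h1 h2; rewrite -cardsX; apply: subset_leq_card; apply/subsetP => -[x y].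
rewrite !in_setX !in_setD /= => /andP[/andP[xn xS] /andP[yn yS]].
have := subsetP h1 y yS; have := subsetP h2 x xS.
rewrite !inE => /andP[cx _] /andP[cy _]; rewrite cx cy /=; apply/andP; split.
  apply: contra xn => ff; apply/nbhdP; exists y => //.
  by rewrite /full_edge inE cx.
apply: contra yn => ff; apply/nbhdP; exists x => //.
by rewrite /full_edge inE cy.
Qed.
End Core.

Lemma archi_mulr (R : realType) (x y : R) : 0 < y -> exists2 n : nat, (0 < n)%N & x <= y * n%:R.
Proof.
move=> y0; exists (Num.bound (`|x| / y)).+1 => //.
apply: le_trans (ler_norm _) _; rewrite mulrC -ler_pdivrMr //.
apply: ltW; apply: lt_trans (archi_boundP _) _; first by rewrite divr_ge0 // ltW.
by rewrite ltr_nat.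
Qed.

(** If there are no such blocks, Hall's alternative gives, for both colours and all n, a set
    that exceeds its neighbourhood by nearly d n.  By the count of irregular pairs, of any
    two such sets of different colours one is nearly contained in the neighbourhood of the
    other, which [double_deficiency] excludes. *)
Theorem monochromatic_blocks (R : realType) (d : R) (s : nat) :
  (5 + 2 * Num.sqrt 2)^-1 < d -> (0 < s)%N ->
  exists C lo0 : nat, (0 < C)%N /\ forall lo, (lo0 <= lo)%N ->
  forall (e : 'I_(C * lo) -> 'I_(C * lo) -> bool) (chi : 'I_(C * lo) -> bool),
  (forall x y, e x y = e y x) ->
  exists kappa n F, [/\ (lo <= n <= C * lo)%N,
    block_family (block e s kappa) (low_class chi (~~ kappa) n) (colour_class chi kappa) F &
    (1 - d) * n%:R <= (#|low_class chi kappa n| + s * size F)%:R].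
Proof.
move=> dlt s0; set d0 := (5 + _)^-1 in dlt.
(* One third of the slack pays for the losses in the blocks, one for the irregular pairs, and
   one for the strict inequality in the zigzag bound. *)
pose eta := (d - d0) / 3.
have eta0 : 0 < eta by rewrite divr_gt0 // subr_gt0.
have [||C [lo1 [C0 H]]] := @double_deficiency R (d0 + eta) (d0 + 2 * eta).
- by rewrite -/d0; lra.
- by lra.
have dE : d = d0 + 3 * eta by rewrite /eta; field.
have [q q0 qC] := archi_mulr (4 * C%:R) eta0.
have [g1 g10 gC] := archi_mulr (C%:R) eta0.
have [K [N0 reg]] := regularity s q (g1 * g1).
pose cst := (s * (K * K) + 2 * K)%N.
have [lo2 lo20 lo2c] := archi_mulr (4 * cst%:R) eta0.
exists C, (maxn (maxn lo1 1) (maxn N0 lo2)); split=> // lo; rewrite !geq_max.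
move=> /andP[/andP[llo1 llo0] /andP[lN0 llo2]] e chi esym.
set N := (C * lo)%N in e chi esym *.
have [|L [lab [LK irr]]] := reg 'I_N e (colour_class chi true) (colour_class chi false).
  by rewrite card_ord (leq_trans lN0) // leq_pmull.
rewrite card_ord in irr.
have lo0R : 0 < lo%:R :> R by rewrite ltr0n.
have NR : N%:R = C%:R * lo%:R :> R by rewrite /N natrM.
apply: contrapT => noF.
pose D n := Num.trunc ((d - eta / 2) * n%:R).
have def kappa n : (lo <= n <= N)%N ->
  exists2 S : {set 'I_N}, S \subset low_class chi (~~ kappa) n &
    (#|nbhd (full_edge e chi s q lab kappa) S| + D n < #|S|)%N.
  move=> /andP[ln nN].
  have [[F fF hF]|//] := @blocks_or_deficiency N e chi esym s q L lab s0 q0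
    kappa n (D n) (leq_trans llo0 ln) nN.
  exfalso; apply: noF; exists kappa, n, F; split=> //; first by rewrite ln.
  have lnR : lo%:R <= n%:R :> R by rewrite ler_nat.
  have DR : (D n)%:R <= (d - eta / 2) * n%:R.
    rewrite truncn_le // mulr_ge0 //.
    have : 0 < d0 by rewrite invr_gt0 ltr_wpDr // mulr_ge0 // sqrtr_ge0.
    by lra.
  have q0R : 0 < q%:R :> R by rewrite ltr0n.
  have c1 : (s * (#|L| * #|L|) + 2 * #|L| <= cst)%N by rewrite leq_add // leq_mul // leq_mul.
  have {}hF : (q * n <= q * (#|low_class chi kappa n| + s * size F) + q * D n + q * cst + N)%N.
    by apply: leq_trans hF _; rewrite leq_add2r -!mulnDr leq_mul2l leq_add2l c1 orbT.
  move: hF; rewrite -(ler_nat R) !natrD !(natrM R q) NR.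
  set u : R := (_ + _ * _)%:R; move=> hF.
  have h1 : C%:R * lo%:R <= q%:R * (eta / 4 * n%:R).
    have h2 : 4 * C%:R * lo%:R <= eta * q%:R * lo%:R by rewrite ler_pM2r.
    have h3 : eta * q%:R * lo%:R <= eta * q%:R * n%:R by rewrite ler_pM2l // mulr_gt0.
    have -> : q%:R * (eta / 4 * n%:R) = eta * q%:R * n%:R / 4 by field.
    by lra.
  have h4 : n%:R <= u + (D n)%:R + cst%:R + eta / 4 * n%:R.
    by rewrite -(ler_pM2l q0R) !mulrDr; lra.
  have h5 : lo2%:R * eta <= n%:R * eta by rewrite ler_pM2r // ler_nat (leq_trans llo2).
  by lra.
have lowE kappa : exists S : nat -> {set 'I_N}, forall n, (lo <= n <= N)%N ->
   S n \subset low_class chi (~~ kappa) n /\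
    (#|nbhd (full_edge e chi s q lab kappa) (S n)| + D n < #|S n|)%N.
  have /choice[S hS] : forall n, exists S : {set 'I_N}, (lo <= n <= N)%N ->
    S \subset low_class chi (~~ kappa) n /\
    (#|nbhd (full_edge e chi s q lab kappa) S| + D n < #|S|)%N.
    move=> n; case: (boolP (lo <= n <= N)%N) => [/(def kappa)[S h1 h2]|_]; first by exists S.
    by exists set0.
  by exists S.
have [S hS] := lowE true; have [S' hS'] := lowE false.
apply: (H lo (fun n => #|nbhd (full_edge e chi s q lab false) (S' n)|) (fun n => #|S' n|)
  (fun n => #|nbhd (full_edge e chi s q lab true) (S n)|) (fun n => #|S n|)
  (N%:R / g1%:R) llo1).
- rewrite NR ler_pdivrMr ?ltr0n //.
  have -> : (d0 + 2 * eta - (d0 + eta)) * lo%:R * g1%:R = eta * g1%:R * lo%:R by ring.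
  by rewrite ler_pM2r.
- move=> n hn.
  have Dn m k : (m + D n < k)%N -> (d0 + 2 * eta) * n%:R <= k%:R - m%:R.
    have : 0 <= eta * n%:R by rewrite mulr_ge0 // ltW.
    have : (d - eta / 2) * n%:R < (D n).+1%:R by apply: truncnS_gt.
    rewrite -[(D n).+1%:R]natr1 => h1 h2 h.
    have : m%:R + (D n)%:R + 1 <= k%:R :> R by rewrite -natrD natr1 ler_nat.
    by rewrite dE in h1; lra.
  have [h1 /Dn h2] := hS n hn; have [h3 /Dn h4] := hS' n hn.
  split; [exact: h4|exact: h2|].
  have /andP[_ nN] := hn.
  by rewrite -[X in (_ <= X)%N](card_low_class chi true nN) leq_add // subset_leq_card.
move=> n m hn hm.
have [h1 _] := hS m hm; have [h3 _] := hS' n hn.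
pose X := nbhd (full_edge e chi s q lab false) (S' n).
pose Y := nbhd (full_edge e chi s q lab true) (S m).
have pr := irregular_product e s q lab h1 h3; rewrite -/X -/Y in pr.
have {pr irr} : (#|S' n :\: Y| * g1 * (#|S m :\: X| * g1) <= N * N)%N.
  rewrite mulnACA mulnn; apply: leq_trans irr; rewrite mulnC leq_mul2l -mulnn.
  by rewrite pr orbT.
have g1R : 0 < g1%:R :> R by rewrite ltr0n.
have cE (A B : {set 'I_N}) : (#|A :\: B| * g1 <= N)%N -> #|A|%:R <= #|B|%:R + N%:R / g1%:R :> R.
  move=> h; have : #|A :\: B|%:R <= N%:R / g1%:R :> R.
    by rewrite ler_pdivlMr // -natrM ler_nat.
  have : (#|A| <= #|B| + #|A :\: B|)%N.
    rewrite -[X in (X <= _)%N](cardsID B) leq_add2r subset_leq_card //.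
    exact: subsetIr.
  by rewrite -(ler_nat R) natrD; lra.
have [h _|h] := leqP (#|S m :\: X| * g1) N; first by left; exact: cE.
have [h' _|h'] := leqP (#|S' n :\: Y| * g1) N; first by right; exact: cE.
by rewrite leqNgt ltn_mul.
Qed.

(** * Infinite embeddings *)

Section UltrafilterColour.
Local Open Scope classical_set_scope.

(** chi v is the colour for which the neighbourhood of v belongs to a fixed nonprincipal
    ultrafilter. *)
Lemma ultrafilter_colour (c : nat -> nat -> bool) : exists chi : nat -> bool,
  forall kappa (F B : seq nat), all (fun v => chi v == kappa) F ->
  exists2 z, z \notin B & all (fun w => c w z == kappa) F.
Proof.
have [G [GU ooG]] := ultraFilterLemma (eventually_filter : ProperFilter \oo).
have PG : ProperFilter G by case: GU.
exists (fun v => `[< G [set u | c v u] >]) => kappa F B hF.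
have Gv v : G [set u | c v u = `[< G [set u | c v u] >]].
  case: asboolP => h; first by apply: filterS h.
  have [//|] := in_ultra_setVsetC [set u | c v u] GU.
  by apply: filterS => u /= /negP/negbTE.
have GF : G [set u | all (fun w => c w u == kappa) F].
  elim: F hF => [_|w F IH /= /andP[/eqP wk /IH GF]]; first exact: filterS filterT.
  apply: filterS (filterI (Gv w) GF) => u [/= -> ->].
  by rewrite wk eqxx.
have GB : G [set u | u \notin B].
  apply: ooG; exists (\max_(b <- B) b).+1 => // u /= hu.
  apply/negP => uB; have := @leq_bigmax_seq _ B xpredT id u uB isT.
  by move=> /(leq_trans hu); rewrite ltnn.
by have [u [h1 h2]] := filter_ex (filterI GB GF); exists u.
Qed.
End UltrafilterColour.

(** Q j stands for a property to be reached by the j-th stage of the construction, besides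
    the placement of the j-th point. *)
Section Limit.
Variables (T : countType) (nb : T -> seq T) (par : T -> bool).
Variables (c : nat -> nat -> bool) (W : pred nat) (kappa : bool).
Hypothesis par_nb : forall x y, y \in nb x -> par y = ~~ par x.
Hypothesis nb_sym : forall x y, y \in nb x -> x \in nb y.
Hypothesis c_sym : forall v w, c v w = c w v.
Hypothesis fresh_vertex : forall B : seq nat, exists2 w, W w & w \notin B.
Hypothesis common_neighbour : forall F B : seq nat, all W F ->
  exists2 z, z \notin B & all (fun w => c w z == kappa) F.
Variable Q : nat -> seq nat -> Prop.
Hypothesis QS : forall j s s', {subset s <= s'} -> Q j s -> Q j s'.
Hypothesis stage : forall p j, partial_embedding nb par c W kappa p ->
  exists2 p', extends nb par c W kappa p p' & Q j (unzip2 p').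

Lemma embedding_limit : exists phi : T -> nat,
  [/\ injective phi, forall x y, y \in nb x -> c (phi x) (phi y) = kappa &
   forall j, exists2 s, Q j s & forall v, v \in s -> exists x, phi x = v].
Proof.
pose ok := partial_embedding nb par c W kappa.
have /choice[f hf] : forall pj : seq (T * nat) * nat, exists p', ok pj.1 ->
    [/\ ok p', {subset pj.1 <= p'}, Q pj.2 (unzip2 p') &
      forall x, unpickle pj.2 = Some x -> x \in unzip1 p'].
  move=> [p j] /=; case: (pselect (ok p)) => [okp|]; last by exists [::].
  have [p1 p1E Qp1] := stage j okp; case E: (unpickle j) => [x|]; last first.
    by exists p1 => _; case: p1E.
  have [p2 [ok2 s12] xp2] := extend_point par_nb fresh_vertex common_neighbour x (proj1 p1E).
  exists p2 => _; split=> // [z /(proj2 p1E)/s12 //||y [<-] //].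
  by apply: QS Qp1; apply: unzip2S.
pose p := fix p j := if j is j'.+1 then f (p j', j') else [::].
have okp j : ok (p j) by elim: j => [|j IH] /=; [by []|case: (hf (p j, j) IH)].
have pS j : {subset p j <= p j.+1} by case: (hf (p j, j) (okp j)).
have pM i j : (i <= j)%N -> {subset p i <= p j}.
  elim: j => [|j IH]; first by rewrite leqn0 => /eqP ->.
  rewrite leq_eqVlt => /orP[/eqP -> //|ij] z /(IH ij); exact: pS.
have /choice[phi hphi] : forall x : T, exists v, (x, v) \in p (pickle x).+1.
  move=> x; have [_ _ _ /(_ x (pickleK x))] := hf (p (pickle x), pickle x) (okp _).
  by move=> /mapP[[y v] h /= E]; exists v; rewrite -E in h.
have fun1 i x v : (x, v) \in p i -> v = phi x.
  move=> xv; pose j := maxn i (pickle x).+1.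
  have h1 := pM _ j (leq_maxl _ _) _ xv; have h2 := pM _ j (leq_maxr _ _) _ (hphi x).
  have [u1 _ _] := okp j; clear -u1 h1 h2; elim: (p j) h1 h2 u1 => //= -[y w] q IH.
  rewrite !inE !xpair_eqE => /orP[/andP[/eqP -> /eqP ->]|h1] /orP[/andP[/eqP E /eqP ->]|h2] //.
  - by move=> /andP[/negP[]]; apply/mapP; exists (y, phi y).
  - by move=> /andP[/negP[]]; rewrite -E; apply/mapP; exists (x, v).
  - by move=> /andP[_]; exact: IH.
have ph i x : x \in unzip1 (p i) -> (x, phi x) \in p i.
  by move=> /mapP[[y v] h /= ->]; rewrite -(fun1 _ _ _ h).
exists phi; split.
- move=> x y xy; pose j := maxn (pickle x).+1 (pickle y).+1.
  have h1 := pM _ j (leq_maxl _ _) _ (hphi x); have h2 := pM _ j (leq_maxr _ _) _ (hphi y).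
  have [_ u2 _] := okp j; rewrite -xy in h2; clear -u2 h1 h2.
  move: (phi x) h1 h2 => v h1 h2; elim: (p j) h1 h2 u2 => //= -[z w] q IH.
  rewrite !inE !xpair_eqE => /orP[/andP[/eqP -> /eqP ->]|h1] /orP[/andP[/eqP -> /eqP E]|h2] //.
  - by move=> /andP[/negP[]]; apply/mapP; exists (y, w).
  - by move=> /andP[/negP[]]; rewrite -E; apply/mapP; exists (x, v).
  - by move=> /andP[_]; exact: IH.
- suff odd x y : par x -> y \in nb x -> c (phi y) (phi x) = kappa.
    move=> x y yx; have := par_nb yx; case px: (par x) => /= py.
      by rewrite c_sym; apply: odd.
    by apply: odd => //; exact: nb_sym.
  move=> px yx; have [_ _ /(_ _ _ (hphi x))] := okp (pickle x).+1.
  by rewrite /edges_ok px => /(_ y yx)[w /fun1 ->].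
- move=> j; have [_ _ Qj _] := hf (p j, j) (okp j).
  exists (unzip2 (p j.+1)) => // v /mapP[[x w] xw /= ->]; exists x.
  by rewrite (fun1 _ _ _ xw).
Qed.
End Limit.

(** * Dense monochromatic copies *)

Definition block_vertices (F : seq (seq nat * seq nat)) := flatten [seq b.1 ++ b.2 | b <- F].

Lemma count_lt_uniq m (s : seq nat) : uniq s -> (count (fun v => v < m)%N s <= m)%N.
Proof.
move=> us; rewrite -size_filter -[X in (_ <= X)%N](size_iota 0 m).
apply: uniq_leq_size; first exact: filter_uniq.
by move=> v; rewrite mem_filter mem_iota /= add0n => /andP[].
Qed.

Lemma few_low_blocks m (F : seq (seq nat * seq nat)) : uniq (block_vertices F) ->
  (size F <= size [seq b <- F | all (leq m) (b.1 ++ b.2)] + m)%N.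
Proof.
move=> uF; apply: leq_trans (leq_add (leqnn _) (count_lt_uniq m uF)); clear uF.
elim: F => [|[X Y] F IH] //=; rewrite count_cat.
case: ifPn => [_|] /=; first by rewrite addSn ltnS (leq_trans IH) // leq_add2l leq_addl.
rewrite -has_predC => h; rewrite addnCA.
suff : (0 < count (fun v => v < m)%N (X ++ Y))%N by move=> h0; exact: leq_add h0 IH.
rewrite -has_count; apply: sub_has h => v /=; by rewrite -ltnNge.
Qed.

Lemma uniq_block_vertices N (blkp : {set 'I_N} -> {set 'I_N} -> bool) (A W : {set 'I_N}) F :
  [disjoint A & W] -> block_family blkp A W F ->
  uniq (block_vertices [seq ([seq val x | x <- enum b.1], [seq val x | x <- enum b.2])
                | b : {set 'I_N} * {set 'I_N} <- F]).
Proof.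
move=> AW /andP[]; elim: F => [|[X Y] F IH] //= /andP[/and3P[XA YW _] aF] /andP[dF pF].
rewrite /block_vertices /= !cat_uniq !(map_inj_uniq val_inj) !enum_uniq /=.
rewrite -/(block_vertices _) IH // !andbT; apply/andP; split.
  apply/hasPn => v /mapP[y yY ->]; apply/negP => /= /mapP[x xX /val_inj xy].
  rewrite mem_enum in yY; rewrite mem_enum -xy in xX.
  by have := disjointFr AW (subsetP XA _ xX); rewrite (subsetP YW).
apply/hasPn => v /flattenP[s /mapP[b' /mapP[b bF ->] ->]] /=.
have /andP[dX dY] := allP dF _ bF; have /and3P[bA bW _] := allP aF _ bF.
rewrite mem_cat => /orP[] /mapP[z]; rewrite mem_enum => zb ->;
  rewrite mem_cat negb_or !mem_map ?mem_enum; try exact: val_inj.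
  rewrite (disjointFl dX zb) /=; apply/negP => zY.
  by have := disjointFr AW (subsetP bA _ zb); rewrite (subsetP YW).
rewrite (disjointFl dY zb) /= andbT; apply/negP => zX.
by have := disjointFl AW (subsetP bW _ zb); rewrite (subsetP XA).
Qed.

Definition colour_block (c : nat -> nat -> bool) (chi : nat -> bool) kappa s n
    (b : seq nat * seq nat) :=
  [/\ uniq (b.1 ++ b.2), size b.1 = s, size b.2 = s,
    all (fun v => (chi v == ~~ kappa) && (v < n)%N) b.1 /\ all (fun v => chi v == kappa) b.2 &
    {in b.1 & b.2, forall v w, c w v = kappa}].

Section Rich.
Variables (R : realType) (c : nat -> nat -> bool) (chi : nat -> bool).
Hypothesis c_sym : forall v w, c v w = c w v.

(** Requiring all blocks to avoid the vertices below m makes it possible to place them after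
    any finite partial embedding. *)
Definition rich_at (d : R) (s : nat) kappa (m : nat) := exists n F,
  [/\ (m <= n)%N, forall b, b \in F -> colour_block c chi kappa s n b, uniq (block_vertices F),
      all (leq m) (block_vertices F) &
      (1 - d) * n%:R <= (count (fun v => chi v == kappa) (iota 0 n) + s * size F)%:R].

(** At most m of the disjoint blocks meet the vertices below m, and removing them costs a
    number of vertices that does not depend on n. *)
Lemma rich_at_some (d : R) s m : (5 + 2 * Num.sqrt 2)^-1 < d -> (0 < s)%N ->
  exists kappa, rich_at d s kappa m.
Proof.
move=> dlt s0; set d0 := (5 + _)^-1 in dlt.
pose d1 := (d0 + d) / 2.
have d01 : d0 < d1 by rewrite /d1; lra.
have d1d : 0 < d - d1 by rewrite /d1; lra.
have [C [lo0 [C0 H]]] := monochromatic_blocks d01 s0.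
have [lo1 lo10 hlo1] := archi_mulr (s * m)%:R d1d.
pose lo := maxn lo0 (maxn lo1 m).
have [|kappa [n [F0 [/andP[ln nN] fam cnt]]]] :=
  H lo _ (fun x y => c x y) (fun x => chi x) (fun x y => c_sym x y).
  exact: leq_maxl.
exists kappa; set N := (C * lo)%N in F0 fam cnt nN *.
pose F1 := [seq ([seq val x | x <- enum b.1], [seq val x | x <- enum b.2])
                | b : {set 'I_N} * {set 'I_N} <- F0].
have dis : [disjoint low_class (fun x : 'I_N => chi x) (~~ kappa) n &
                     colour_class (fun x : 'I_N => chi x) kappa].
  rewrite disjoint_subset; apply/subsetP => x.
  by rewrite !inE => /andP[/eqP -> _]; case: (kappa).
have uF1 : uniq (block_vertices F1) by exact: uniq_block_vertices dis fam.
pose F := [seq b <- F1 | all (leq m) (b.1 ++ b.2)].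
have subF : subseq (block_vertices F) (block_vertices F1).
  rewrite /F; elim: (F1) => //= b F' IH; case: ifP => _ /=.
    exact: cat_subseq.
  exact: subseq_trans IH (suffix_subseq _ _).
exists n, F; split.
- by apply: leq_trans ln; rewrite !leq_max leqnn !orbT.
- move=> b; rewrite mem_filter => /andP[_ bF1].
  have /mapP[[X Y] /= XY bE] := bF1.
  case/andP: fam => /allP/(_ _ XY)/and3P[/= XA YW /and3P[/eqP cX /eqP cY /forall_inP com]] _.
  have ub : uniq (b.1 ++ b.2).
    move: uF1; rewrite /block_vertices => /(subseq_uniq _); apply.
    elim: (F1) bF1 => //= b' F' IH; rewrite inE => /predU1P[->|/IH h].
      exact: prefix_subseq.
    exact: subseq_trans h (suffix_subseq _ _).
  split; rewrite ?ub // bE /= ?size_map -?cardE //.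
    split; apply/allP => v /mapP[x]; rewrite mem_enum => xX ->.
      by have := subsetP XA _ xX; rewrite inE.
    by have := subsetP YW _ xX; rewrite inE.
  move=> v w /mapP[x]; rewrite mem_enum => xX -> /mapP[y]; rewrite mem_enum => yY ->.
  by rewrite c_sym; apply/eqP; have /forall_inP := com _ xX; apply.
- exact: subseq_uniq subF uF1.
- apply/allP => v /flattenP[s' /mapP[b]]; rewrite mem_filter => /andP[/allP bm _] -> .
  exact: bm.
have low : (#|low_class (fun x : 'I_N => chi x) kappa n| <= count (fun v => chi v == kappa) (iota 0 n))%N.
  rewrite -size_filter cardE -(size_map val); apply: uniq_leq_size.
    by rewrite map_inj_uniq ?enum_uniq //; exact: val_inj.
  move=> v /mapP[x]; rewrite mem_enum inE => /andP[xk xn] ->.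
  by rewrite mem_filter xk mem_iota /= add0n.
have few := few_low_blocks m uF1; rewrite size_map -/F in few.
have : (#|low_class (fun x : 'I_N => chi x) kappa n| + s * size F0 <=
   count (fun v => chi v == kappa) (iota 0 n) + s * size F + s * m)%N.
  by rewrite -addnA leq_add // -mulnDr leq_mul2l few orbT.
rewrite -(ler_nat R) natrD => h.
have h2 : (d - d1) * lo1%:R <= (d - d1) * n%:R.
  by rewrite ler_pM2l // ler_nat (leq_trans _ ln) // !leq_max leqnn orbT.
by lra.
Qed.

Lemma rich_at_leq d s kappa m m' : (m <= m')%N -> rich_at d s kappa m' -> rich_at d s kappa m.
Proof.
move=> mm [n [F [h1 h2 h3 h4 h5]]]; exists n, F; split => //.
  exact: leq_trans h1.
by apply: sub_all h4 => v; exact: leq_trans.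
Qed.

(** The property becomes stronger as m grows, so that one colour works for all m. *)
Lemma rich_colour (d : R) s : (5 + 2 * Num.sqrt 2)^-1 < d -> (0 < s)%N ->
  exists kappa, forall m, rich_at d s kappa m.
Proof.
move=> dlt s0; apply: contrapT => no.
have nokp kappa : exists m, ~ rich_at d s kappa m.
  by apply: contrapT => h; apply: no; exists kappa => m; apply: contrapT => h'; apply: h; exists m.
have [m1 h1] := nokp true; have [m2 h2] := nokp false.
have [[] h] := rich_at_some (maxn m1 m2) dlt s0.
  by apply: h1; apply: rich_at_leq h; rewrite leq_maxl.
by apply: h2; apply: rich_at_leq h; rewrite leq_maxr.
Qed.

(** If the class were finite, then for large m there would be no blocks at all, and the class
    alone would cover a positive proportion. *)
Lemma rich_infinite (d : R) s kappa : d < 1 -> (0 < s)%N -> (forall m, rich_at d s kappa m) ->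
  forall B : seq nat, exists2 w, chi w == kappa & w \notin B.
Proof.
move=> d1 s0 rich B; apply: contrapT => no.
have sub w : chi w == kappa -> w \in B.
  by move=> cw; apply: contrapT => /negP wB; apply: no; exists w.
have [|M M0 hM] := @archi_mulr R (size B).+1%:R (1 - d); first by rewrite subr_gt0.
pose m := maxn M (\max_(b <- B) b).+1.
have [n [[|b F] [mn bF uF mF]]] := rich m.
  rewrite muln0 addn0; apply/negP; rewrite -ltNge.
  have : (count (fun v => chi v == kappa) (iota 0 n) <= size B)%N.
    rewrite -size_filter; apply: uniq_leq_size; first by rewrite filter_uniq ?iota_uniq.
    by move=> w; rewrite mem_filter => /andP[/sub].
  rewrite -ltnS -(ltr_nat R) => /lt_le_trans; apply; apply: (le_trans hM).
  rewrite ler_pM2l ?subr_gt0 // ler_nat (leq_trans _ mn) // leq_maxl //.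
have [_ _ sY [_ aY] _] := bF b (mem_head _ _).
move: sY aY mF; case: b bF uF => X [|w Y] /= _ _; first by move=> s00; rewrite -s00 in s0.
move=> _ /andP[/sub wB _] mF.
have : (m <= w)%N by apply: (allP mF); rewrite /block_vertices /= !mem_cat inE eqxx orbT.
rewrite geq_max => /andP[_]; have := @leq_bigmax_seq _ B xpredT id w wB isT.
by move=> /leq_ltn_trans h /h; rewrite ltnn.
Qed.
End Rich.

Section DenseCopy.
Variables (R : realType) (T : countType) (nb : T -> seq T) (par : T -> bool).
Hypothesis par_nb : forall x y, y \in nb x -> par y = ~~ par x.
Hypothesis nb_sym : forall x y, y \in nb x -> x \in nb y.

Hypothesis patches : forall eta : R, 0 < eta -> exists k l : nat,
  [/\ (0 < l)%N, l%:R <= (1 + eta) * k%:R, (k <= l)%N & has_patches nb par k l].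

(** Each stage places the blocks for some large n in fresh patches, and then all remaining
    vertices of the class kappa below n at even points.  Of a block with l vertices on
    either side only k are used outside the class, a loss which the patches make small. *)
Theorem dense_copy (c : nat -> nat -> bool) (lam : R) :
  (forall v w, c v w = c w v) -> 0 < lam -> lam < 1 - (5 + 2 * Num.sqrt 2)^-1 ->
  exists (phi : T -> nat) (kappa : bool),
  [/\ injective phi, forall x y, y \in nb x -> c (phi x) (phi y) = kappa &
   forall j, exists2 n, (j <= n)%N &
     lam * n%:R <= (count (fun v => `[< exists x, phi x = v >]) (iota 0 n))%:R].
Proof.
move=> c_sym lam0; set d0 := (5 + _)^-1 => lam1.
have d00 : 0 < d0 by rewrite invr_gt0 ltr_wpDr // mulr_ge0 // sqrtr_ge0.
pose gam := (1 - lam - d0) / 2; pose d := d0 + gam.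
have gam0 : 0 < gam by rewrite /gam; lra.
have dE : 1 - d = lam + gam by rewrite /d /gam; field.
have [k [l [l0 lk kl pat]]] := patches gam0.
have [chi common] := ultrafilter_colour c.
have [kappa rich] : exists kappa, forall m, rich_at c chi d l kappa m.
  by apply: rich_colour; rewrite // -/d0 /d; lra.
pose W v := chi v == kappa.
have fresh : forall B : seq nat, exists2 w, W w & w \notin B.
  by apply: rich_infinite rich => //; lra.
pose Q j (s : seq nat) := exists2 n, (j <= n)%N & lam * n%:R <= (count (mem s) (iota 0 n))%:R.
have fresh_even (D : seq T) : exists2 x : T, ~~ par x & x \notin D.
  have [I [[|x J] [[_ _ _ sJ] [_ pJ] _ IJD]]] := pat D; first by rewrite -sJ in l0.
  exists x; first by move: pJ; rewrite /= negb_or => /andP[].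
  by move: IJD; rewrite has_cat /= !negb_or => /andP[_ /andP[]].
have [||phi [phi_inj phi_col phiQ]] := @embedding_limit T nb par c W kappa par_nb nb_sym c_sym fresh
    (fun F B => common kappa F B) Q.
- move=> j s s' ss' [n jn hn]; exists n => //; apply: (le_trans hn).
  by rewrite ler_nat; apply: sub_count => v; exact: ss'.
- move=> p j pp.
  pose m := maxn j (\max_(v <- unzip2 p) v).+1.
  have [n [F [mn bF uF mF cF]]] := rich m.
  pose F' := [seq (take k b.1, b.2) | b <- F].
  have sub1 : subseq (block_vertices F') (block_vertices F).
    rewrite /F' /block_vertices; elim: (F) => //= b F1 IH; apply: cat_subseq => //.
    by apply: cat_subseq => //; exact: take_subseq.
  have sub2 : subseq (flatten [seq b.1 | b <- F']) (block_vertices F').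
    rewrite /block_vertices; elim: (F') => //= b F1 IH; apply: cat_subseq => //.
    exact: prefix_subseq.
  have [|||p1 p1E p1F] := @extend_blocks T nb par c W kappa k l pat F' p pp.
  - move=> b /mapP[[X Y] /bF[/= uXY sX sY [aX aY] com] ->] /=; split => //.
    + apply: subseq_uniq uXY; apply: cat_subseq => //; exact: take_subseq.
    + by rewrite size_takel // sX.
    + by move=> v w /mem_take; exact: com.
  - exact: subseq_uniq uF.
  - apply/hasPn => v /(mem_subseq sub1) /(allP mF) mv; apply/negP => /= vp.
    have := @leq_bigmax_seq _ (unzip2 p) xpredT id v vp isT.
    by move: mv; rewrite geq_max => /andP[_] /leq_trans h /h; rewrite ltnn.
  pose S := [seq v <- iota 0 n | W v].
  have [|p2 p2E p2S] := extend_vertices fresh_even (proj1 p1E) (s := S).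
    by apply/allP => v; rewrite mem_filter => /andP[].
  exists p2; first exact: extends_trans p1E p2E.
  exists n; first by apply: leq_trans mn; rewrite leq_maxl.
  have big : (count (fun v => chi v == kappa) (iota 0 n) + k * size F <=
      count (mem (unzip2 p2)) (iota 0 n))%N.
    have sz : size (flatten [seq b.1 | b <- F']) = (k * size F)%N.
      rewrite /F'; elim: (F) bF => [|b F1 IH] hF /=; first by rewrite muln0.
      rewrite size_cat IH; last by move=> b' h; apply: hF; rewrite inE h orbT.
      have [_ sb _ _ _] := hF b (mem_head _ _).
      by rewrite size_takel ?sb // mulnS.
    rewrite -sz -!size_filter -size_cat; apply: uniq_leq_size.
      rewrite cat_uniq filter_uniq ?iota_uniq //= (subseq_uniq sub2) ?(subseq_uniq sub1) // andbT.
      apply/hasPn => v /flattenP[s /mapP[b' /mapP[b /bF[_ _ _ [aX _] _] ->] ->]] /= /mem_take.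
      by move=> /(allP aX) /andP[/eqP ck _]; rewrite mem_filter ck; case: (kappa).
    move=> v; rewrite mem_cat mem_filter => /orP[vS|vF].
      apply/andP; split; first exact: p2S.
      by move: vS; rewrite mem_filter => /andP[].
    apply/andP; split; first exact: (unzip2S (proj2 p2E) (p1F _ vF)).
    case/flattenP: vF => s /mapP[b' /mapP[b /bF[_ _ _ [aX _] _] ->] ->] /= /mem_take.
    by move=> /(allP aX) /andP[_ vn]; rewrite mem_iota.
  apply: le_trans (_ : _ <= (count (fun v => chi v == kappa) (iota 0 n) + k * size F)%:R) _;
    last by rewrite ler_nat.
  move: cF; rewrite dE !natrD !natrM.
  set u : R := (count _ _)%:R; set z : R := (size F)%:R => cF.
  have z0 : 0 <= z by [].
  have u0 : 0 <= u by [].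
  have h1 : l%:R * z <= (1 + gam) * k%:R * z by rewrite ler_wpM2r.
  have h2 : lam * (n%:R * gam) <= n%:R * gam.
    by rewrite ler_piMl // ?mulr_ge0 //; lra.
  have h3 : (1 + gam) * (lam * n%:R) <= (1 + gam) * (u + k%:R * z).
    have : 0 <= gam * u by rewrite mulr_ge0 // ltW.
    lra.
  by rewrite ler_pM2l in h3 => //; lra.
exists phi, kappa; split=> // j; have [s [n jn hn] hs] := phiQ j.
exists n => //; apply: (le_trans hn); rewrite ler_nat; apply: sub_count => v /hs vs.
exact/asboolP.
Qed.
End DenseCopy.

(** * Geometry of the grid *)

Section Grid.
Variables (R : realType) (d : nat).
Notation point := ('rV[int]_d).
Implicit Types (x y : point) (i : 'I_d).

(** The basis vector e_i for b = false, and - e_i for b = true. *)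
Definition unit_step i (b : bool) : point := (-1) ^+ b *: delta_mx 0 i.

Definition grid_nb x : seq point := [seq x + unit_step ib.1 ib.2 | ib <- enum {: 'I_d * bool}].

Lemma grid_nbP x y : reflect (exists i b, y = x + unit_step i b) (y \in grid_nb x).
Proof.
apply: (iffP mapP) => [[[i b] _ ->]|[i [b ->]]]; first by exists i, b.
by exists (i, b); rewrite // mem_enum.
Qed.

Lemma unit_stepE i b j : unit_step i b 0 j = (-1) ^+ b * (j == i)%:R.
Proof. by rewrite !mxE eqxx. Qed.

Lemma adj_gridP x y : adj (grid R d) x y <-> y \in grid_nb x.
Proof.
have E : adj (grid R d) x y <-> \sum_i (y 0 i - x 0 i) ^+ 2 = 1.
  rewrite /= /euclidean_dist.
  have -> : \sum_(i < d) (map_mx intr x 0 i - map_mx intr y 0 i) ^+ 2 =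
      (\sum_i (y 0 i - x 0 i) ^+ 2)%:~R :> R.
    rewrite rmorph_sum; apply: eq_bigr => i _; rewrite !mxE rmorphXn rmorphB /=.
    by rewrite -sqrrN opprB.
  have s0 : 0 <= (\sum_i (y 0 i - x 0 i) ^+ 2)%:~R :> R.
    by rewrite ler0z sumr_ge0 // => i _; rewrite sqr_ge0.
  split=> [h|->]; last by rewrite sqrtr1.
  by apply: (@intr_inj R); rewrite -(sqr_sqrtr s0) h expr1n.
split=> [/E s1|/grid_nbP[i [b yE]]]; last first.
  have yj j : y 0 j - x 0 j = (-1) ^+ b * (j == i)%:R.
    by rewrite yE [_ 0 j]mxE unit_stepE addrAC subrr add0r.
  apply/E; rewrite (bigD1 i) //= big1 => [|j /negbTE ji]; rewrite yj.
    by rewrite eqxx mulr1 sqrr_sign addr0.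
  by rewrite ji mulr0 expr0n.
have [i xyi] : exists i, y 0 i != x 0 i.
  apply/existsP; rewrite -negb_forall; apply/negP => /forallP h.
  move: s1; rewrite big1 // => i _.
  by have /eqP -> := h i; rewrite subrr expr0n.
have pos j : 0 <= (y 0 j - x 0 j) ^+ 2 by rewrite sqr_ge0.
move: s1; rewrite (bigD1 i) //= => s1.
have rest : \sum_(j < d | j != i) (y 0 j - x 0 j) ^+ 2 = 0.
  have : 0 <= \sum_(j < d | j != i) (y 0 j - x 0 j) ^+ 2 by apply: sumr_ge0.
  have : 0 < (y 0 i - x 0 i) ^+ 2 by rewrite lt0r sqr_ge0 andbT expf_neq0 // subr_eq0.
  by move: s1; move: (\sum_(_ < d | _) _) (_ ^+ 2) => u v; lia.
have off j : j != i -> y 0 j = x 0 j.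
  move=> ji; have /eqP := rest; rewrite psumr_eq0 // => /allP/(_ j (mem_index_enum _)).
  by rewrite ji sqrf_eq0 subr_eq0 => /eqP.
rewrite rest addr0 in s1.
apply/grid_nbP; exists i.
have : (y 0 i - x 0 i == 1) || (y 0 i - x 0 i == -1) by rewrite -sqrf_eq1 s1.
case/orP => /eqP h; [exists false|exists true]; apply/rowP => j; rewrite mxE unit_stepE.
  case: (eqVneq j i) => [->|/off ->]; last by rewrite mulr0 addr0.
  by rewrite expr0 mulr1 -h addrC subrK.
case: (eqVneq j i) => [->|/off ->]; last by rewrite mulr0 addr0.
by rewrite expr1 mulr1 -h addrC subrK.
Qed.

Lemma grid_nb_sym x y : y \in grid_nb x -> x \in grid_nb y.
Proof.
case/grid_nbP => i [b ->]; apply/grid_nbP; exists i, (~~ b).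
by rewrite -addrA -scalerDl signrN subrr scale0r addr0.
Qed.

Definition parity x := odd (absz (\sum_i x 0 i)).

Lemma parity_step x i b : parity (x + unit_step i b) = ~~ parity x.
Proof.
rewrite /parity; under eq_bigr do rewrite mxE unit_stepE.
rewrite big_split /= (bigD1 i (P := predT) (F := fun j => (-1) ^+ b * (j == i)%:R)) //= eqxx.
rewrite [X in _ + (_ + X)]big1 => [|j /negbTE ->]; last by rewrite mulr0.
rewrite addr0 (_ : true%:R = 1) // mulr1; move: (\sum_(_ < d) _) => s.
by case: b; rewrite ?expr0 ?expr1; lia.
Qed.

Lemma parity_nb x y : y \in grid_nb x -> parity y = ~~ parity x.
Proof. by case/grid_nbP => i [b ->]; rewrite parity_step. Qed.

Section Box.
Variables (t : int) (m : nat).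
Definition box_point (f : {ffun 'I_d -> 'I_(m + m)}) : point := \row_i (t + (f i)%:Z).
Definition box (p : bool) : seq point :=
  [seq box_point f | f <- enum {ffun 'I_d -> 'I_(m + m)} & parity (box_point f) == p].

Lemma box_point_inj : injective box_point.
Proof.
move=> f g /rowP h; apply/ffunP => i; apply: val_inj => /=.
by have := h i; rewrite !mxE => /addrI [].
Qed.

Lemma uniq_box p : uniq (box p).
Proof. rewrite (map_inj_uniq box_point_inj) filter_uniq ?enum_uniq //. Qed.

Lemma mem_box p x : (x \in box p) =
  (parity x == p) && [forall i, (t <= x 0 i) && (x 0 i < t + (m + m)%:Z)].
Proof.
apply/mapP/andP => [[f]|[xp /forallP bx]].
  rewrite mem_filter => /andP[fp _] ->; split=> //; apply/forallP => i.
  rewrite mxE; move: (ltn_ord (f i)); move: (nat_of_ord (f i)) => k.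
  lia.
have lt i : (absz (x 0 i - t)%R < m + m)%N by have := bx i; lia.
exists [ffun i => Ordinal (lt i)]; last first.
  by apply/rowP => i; rewrite mxE ffunE /=; have := bx i; lia.
rewrite mem_filter mem_enum andbT.
suff -> : box_point [ffun i => Ordinal (lt i)] = x by [].
by apply/rowP => i; rewrite mxE ffunE /=; have := bx i; lia.
Qed.

Hypothesis d0 : (0 < d)%N.

(** Changing the lowest bit of one coordinate exchanges the two parities. *)
Lemma size_box p : (2 * size (box p) = (m + m) ^ d)%N.
Proof.
pose i0 := Ordinal d0.
have flipP (k : 'I_(m + m)) : ((if odd k then k.-1 else k.+1) < m + m)%N.
  by have := ltn_ord k; case: ifP; lia.
pose flip (f : {ffun 'I_d -> 'I_(m + m)}) :=
  [ffun i => if i == i0 then Ordinal (flipP (f i)) else f i].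
have flipK : involutive flip.
  move=> f; apply/ffunP => i; rewrite !ffunE; case: eqP => // _.
  by apply: val_inj => /=; case: ifP; case: ifP; lia.
have flip_par f : parity (box_point (flip f)) = ~~ parity (box_point f).
  rewrite /parity (bigD1 i0) //= [in RHS](bigD1 i0) //= !mxE !ffunE eqxx /=.
  rewrite (eq_bigr (fun i => box_point f 0 i)); last first.
    by move=> i /negbTE ii; rewrite !mxE ffunE ii.
  by move: (\sum_(i < d | _) _) => s; case: ifP; lia.
have sz q : size (box q) = #|[set f | parity (box_point f) == q]|.
  rewrite size_map cardE; apply/perm_size/uniq_perm.
  - by rewrite filter_uniq // enum_uniq.
  - exact: enum_uniq.
  - move=> f; rewrite mem_filter !mem_enum.
    rewrite in_set.
    by rewrite andbT.
have E q : #|[set f | parity (box_point f) == q]| = #|[set f | parity (box_point f) == ~~ q]|.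
  rewrite -(card_imset _ (inv_inj flipK)); congr #|pred_of_set _|; apply/setP => f.
  rewrite !inE; apply/imsetP/idP => [[g]|h].
    by rewrite inE => /eqP gq ->; rewrite flip_par gq.
  exists (flip f); last by rewrite flipK.
  by rewrite inE flip_par (eqP h) negbK.
rewrite mul2n -addnn {2}sz E -sz sz sz.
have -> : [set f | parity (box_point f) == ~~ p] = ~: [set f | parity (box_point f) == p].
  by apply/setP => f; rewrite !inE; case: (parity _); case: (p).
by rewrite cardsC card_ffun !card_ord.
Qed.
End Box.
End Grid.

Lemma bernoulli (R : realType) (t : R) n : 0 <= t -> t <= 1 -> 1 - n%:R * t <= (1 - t) ^+ n.
Proof.
move=> t0 t1; elim: n => [|n IH]; first by rewrite mul0r subr0 expr0.
rewrite exprS; apply: le_trans (_ : (1 - t) * (1 - n%:R * t) <= _);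
  last by rewrite ler_wpM2l // subr_ge0.
have : 0 <= n%:R * (t * t) by rewrite !mulr_ge0.
by rewrite -natr1; lra.
Qed.

(** The odd points of a cube of side 2 m have all their neighbours among the even points of
    the concentric cube of side 2 m + 2, and ((m + 1) / m)^d tends to 1.  The cube avoids D
    when it is far away in one coordinate. *)
Lemma grid_patches (R : realType) d (eta : R) : (0 < d)%N -> 0 < eta -> exists k l : nat,
  [/\ (0 < l)%N, l%:R <= (1 + eta) * k%:R, (k <= l)%N & has_patches (@grid_nb d) (@parity d) k l].
Proof.
move=> d0 eta0.
have [m m0 hm] := archi_mulr (d%:R * (1 + eta)) eta0.
have sz t n p : (2 * size (@box d t n p) = (n + n) ^ d)%N by exact: size_box.
exists (size (@box d 0 m true)), (size (@box d 0 m.+1 false)); split.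
- by rewrite -(ltn_pmul2l (ltn0Sn 1)) muln0 sz expn_gt0.
- rewrite -(ler_pM2l (ltr0n R 2)) mulrCA -!natrM !sz.
  pose u : R := (m.+1 + m.+1)%:R.
  have u0 : 0 < u by rewrite ltr0n.
  pose t : R := m.+1%:R^-1.
  have t0 : 0 < t by rewrite invr_gt0 ltr0n.
  have t1 : t <= 1 by rewrite invf_le1 ?ltr0n // ler1n.
  have mE : (m + m)%:R = u * (1 - t).
    rewrite mulrBr mulr1 /u /t -[m.+1]addn1 !natrD /=; field.
    by rewrite natr1 pnatr_eq0.
  rewrite !natrX mE exprMn -/u mulrCA -[X in X <= _]mulr1 ler_pM2l ?exprn_gt0 //.
  have := bernoulli d (ltW t0) t1; move=> b.
  apply: le_trans (_ : 1 <= (1 + eta) * (1 - d%:R * t)) _; last by rewrite ler_pM2l //; lra.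
  have : d%:R * (1 + eta) * t <= eta.
    rewrite ler_pdivrMr ?ltr0n // (le_trans hm) // ler_pM2l // ler_nat //.
  lra.
- by rewrite -(leq_pmul2l (ltn0Sn 1)) !sz leq_exp2r // leq_add.
move=> D; pose i0 := Ordinal d0.
pose t : int := 2 + \sum_(x <- D) `|x 0 i0|.
have tD x : x \in D -> x 0 i0 < t - 1.
  move=> xD; rewrite /t (big_rem x) //=.
  have : 0 <= \sum_(y <- rem x D) `|y 0 i0| by apply: sumr_ge0.
  move: (ler_norm (x 0 i0)); move: (\sum_(_ <- _) _) (x 0 i0) => u v; lia.
exists (@box d t m true), (@box d (t - 1) m.+1 false); split.
- split; rewrite ?uniq_box //.
  + by apply/eqP; rewrite -(eqn_pmul2l (ltn0Sn 1)) !sz.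
  + by apply/eqP; rewrite -(eqn_pmul2l (ltn0Sn 1)) !sz.
- split; first by apply/allP => x; rewrite mem_box eqb_id => /andP[].
  by apply/hasPn => x; rewrite mem_box eqbF_neg => /andP[].
- move=> x y; rewrite !mem_box => /andP[/eqP px /forallP bx] ynb.
  rewrite (parity_nb ynb) px /=; apply/forallP => j; have := bx j.
  case/grid_nbP: ynb => i [b ->]; rewrite [(_ + _ : 'rV_d) 0 j]mxE unit_stepE.
  have -> : (j == i)%:R = (if j == i then 1 else 0) :> int by case: (j == i).
  move: (x 0 j) (t) => u t'.
  by case: b; case: (j == i); rewrite ?expr0 ?expr1 ?mulr0 ?mulr1; lia.
- clearbody t; apply/hasPn => x; rewrite mem_cat => xIJ; apply/negP => /= /tD xt.
  have : t - 1 <= x 0 i0.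
    case/orP: xIJ; rewrite mem_box => /andP[_ /forallP/(_ i0)/andP[h _]] //.
    by apply: le_trans h; rewrite gerBl.
  by rewrite leNgt xt.
Qed.

(** * The value of h at 0 *)

Section Gamma.
Local Open Scope classical_set_scope.
Variable R : realType.
Implicit Types (g : R -> R) (t x : R).

Definition nonexpansive g := forall x y, 0 <= x -> 0 <= y -> `|g x - g y| <= `|x - y|.

Lemma lipschitz_nonexpansive g : 1.-lipschitz_(`[0, +oo[) g -> nonexpansive g.
Proof.
move=> h x y x0 y0.
have := h (x, y); rewrite /= mul1r; apply.
by split; rewrite /= in_itv /= andbT.
Qed.

Lemma nonexpansiveN g : nonexpansive g -> nonexpansive (fun x => - g x).
Proof. by move=> h x y x0 y0; rewrite -opprD normrN; exact: h. Qed.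

Definition reach g t : set R := [set x | 0 <= x /\ t <= g x].
Definition first_reach g t : \bar R := ereal_min [set x%:E | x in reach g t].

Lemma Gamma_plus0 g t : Gamma_plus 0 g t = first_reach g t.
Proof.
congr ereal_min; apply/seteqP; split=> _ [x [x0 tx] <-]; exists x => //; split=> //.
  by rewrite mul0r add0r in tx.
by rewrite mul0r add0r.
Qed.

Lemma Gamma_minus0 g t : Gamma_minus 0 g t = first_reach (fun x => - g x) t.
Proof.
congr ereal_min; apply/seteqP; split=> _ [x [x0 tx] <-]; exists x => //; split=> //.
  by rewrite mul0r add0r in tx.
by rewrite mul0r add0r.
Qed.

Lemma first_reachP g t : first_reach g t = +oo%E \/
  exists x, [/\ first_reach g t = x%:E, reach g t x & forall y, reach g t y -> x <= y].
Proof.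
rewrite /first_reach /ereal_min; case: xgetP => [y _ [[x rx <-] lb]|]; last by left.
right; exists x; split=> // z rz.
by have := lb z%:E (classical_sets.imageP _ rz); rewrite lee_fin.
Qed.

(** By continuity the infimum of the reaching times is attained. *)
Lemma first_reach_le g t x : nonexpansive g -> reach g t x -> (first_reach g t <= x%:E)%E.
Proof.
move=> lg rx; pose S := reach g t.
have lb0 : lbound S 0 by move=> y [].
have hinf : has_inf S by split; [exists x|exists 0].
have i0 : 0 <= inf S by apply: lb_le_inf => //; exists x.
have ri : reach g t (inf S).
  split=> //; apply/ler_addgt0Pr => e e0.
  have [y [y0 ty] ye] := inf_adherent e0 hinf.
  have iy : inf S <= y by apply: ge_inf => //; exists 0.
  have := lg y (inf S) y0 i0; rewrite [X in _ <= X]ger0_norm ?subr_ge0 //.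
  have := ler_norm (g y - g (inf S)); lra.
have mi : forall y, reach g t y -> inf S <= y by move=> y ry; apply: ge_inf => //; exists 0.
rewrite /first_reach /ereal_min; case: xgetP => [y _ [_ lb]|no].
  exact: lb (classical_sets.imageP _ rx).
exfalso; apply: (no (inf S)%:E); split; first exact: classical_sets.imageP.
by move=> _ [y ry <-]; rewrite lee_fin mi.
Qed.

(** Going back from the first time at height m by m - n loses at most m - n in height, so
    that height n is reached before. *)
Lemma first_reach_zigzag g (lo hi : nat) (a b : nat -> R) : nonexpansive g -> g 0 = 0 ->
  (forall n, (lo <= n)%N -> first_reach g n%:R = (a n)%:E) ->
  (forall n, (lo <= n)%N -> first_reach (fun x => - g x) n%:R = (b n)%:E) ->
  zigzag lo hi a b.
Proof.
move=> lg g0 ha hb.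
have first (g' : R -> R) (c : nat -> R) n : first_reach g' n%:R = (c n)%:E ->
    reach g' n%:R (c n) /\ forall y, reach g' n%:R y -> c n <= y.
  by move=> h; case: (first_reachP g' n%:R); rewrite h // => -[x [[->] h1 h2]].
have grow (g' : R -> R) (c : nat -> R) : nonexpansive g' -> g' 0 = 0 ->
    (forall n, (lo <= n)%N -> first_reach g' n%:R = (c n)%:E) ->
    forall n m, (lo <= n)%N -> (n <= m)%N -> (m <= hi)%N -> c n + (m%:R - n%:R) <= c m.
  move=> lg' g'0 hc n m ln nm _.
  have [[cm0 gm] _] := first g' c m (hc m (leq_trans ln nm)).
  have [_ minn] := first g' c n (hc n ln).
  have nmR : n%:R <= m%:R :> R by rewrite ler_nat.
  have mc : m%:R <= c m.
    have := lg' (c m) 0 cm0 (lexx 0); rewrite g'0 !subr0 (ger0_norm cm0).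
    by have := ler_norm (g' (c m)); lra.
  have n0 : 0 <= n%:R :> R by [].
  have x0 : 0 <= c m - (m%:R - n%:R) by lra.
  suff : c n <= c m - (m%:R - n%:R) by lra.
  apply: minn; split=> //.
  have := lg' (c m) _ cm0 x0.
  have -> : c m - (c m - (m%:R - n%:R)) = m%:R - n%:R by ring.
  rewrite [X in _ <= X]ger0_norm ?subr_ge0 //.
  by have := ler_norm (g' (c m) - g' (c m - (m%:R - n%:R))); lra.
split.
- move=> n /andP[ln _]; split.
    by have [[]] := first g a n (ha n ln).
  by have [[]] := first _ b n (hb n ln).
- exact: grow ha.
- by apply: grow hb; [exact: nonexpansiveN|rewrite g0 oppr0].
- move=> n m /andP[ln _] /andP[lm _].
  have [[a0 ga] _] := first g a n (ha n ln); have [[b0 gb] _] := first _ b m (hb m lm).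
  apply: le_trans (lg _ _ a0 b0).
  by have := ler_norm (g (a n) - g (b m)); lra.
Qed.

(** If the upper limit were smaller, then the first times at large heights would be finite
    and form a zigzag with a sum bounded by K n for some K < 8 + 4 sqrt 2. *)
Lemma limsup_first_reach g : nonexpansive g -> g 0 = 0 ->
  ((8 + 4 * Num.sqrt 2)%:E <= limf_esup (fun t : R =>
      (Gamma_plus 0 g t + Gamma_minus 0 g t) * t^-1%:E) (pinfty_nbhs R))%E.
Proof.
move=> lg g0; pose ng x := - g x; apply: le_ereal_inf_tmp => _ [V [M [_ MV]] <-].
rewrite leNgt; apply/negP => lt8.
have [K K8 hK] : exists2 K : R, K < 8 + 4 * Num.sqrt 2 & forall t : R, M < t ->
    ((first_reach g t + first_reach ng t) * t^-1%:E <= K%:E)%E.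
  have ub t : M < t -> ((first_reach g t + first_reach ng t) * t^-1%:E <=
     ereal_sup [set ((Gamma_plus 0 g t + Gamma_minus 0 g t) * t^-1%:E)%E | t in V])%E.
    by move=> /MV Vt; apply: ereal_sup_ubound; exists t => //; rewrite Gamma_plus0 Gamma_minus0.
  move: lt8 ub; case: (ereal_sup _) => [r||] // h ub; first by exists r; rewrite ?lte_fin // in h *.
  by exists 0 => [|t /ub/le_trans]; [rewrite ltr_wpDr // mulr_ge0 // sqrtr_ge0|apply; exact: leNye].
have [C [n0 [C0 H]]] := zigzag_slow K8.
pose lo := maxn n0 (Num.bound `|M|).+1.
have fin n : (lo <= n)%N -> first_reach g n%:R = (fine (first_reach g n%:R))%:E /\
    first_reach ng n%:R = (fine (first_reach ng n%:R))%:E.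
  rewrite geq_max => /andP[_ Mn].
  have n00 : 0 < n%:R :> R by rewrite ltr0n (leq_trans _ Mn).
  have := hK n%:R; have -> : M < n%:R.
    apply: le_lt_trans (ler_norm M) _; apply: lt_trans (archi_boundP (normr_ge0 M)) _.
    by rewrite ltr_nat.
  move=> /(_ isT).
  have inv0 : (0 < (n%:R : R)^-1%:E)%E by rewrite lte_fin invr_gt0.
  case: (first_reachP g n%:R) => [->|[x [-> _ _]]];
  case: (first_reachP ng n%:R) => [->|[y [-> _ _]]] //=;
  by rewrite ?addye ?addey ?gt0_mulye.
have zz := first_reach_zigzag (C * lo) lg g0 (fun n h => proj1 (fin n h)) (fun n h => proj2 (fin n h)).
have [n /andP[ln _]] := H lo _ _ (leq_maxl _ _) zz.
have [f1 f2] := fin n ln.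
have Mn : M < n%:R.
  apply: le_lt_trans (ler_norm M) _; apply: lt_trans (archi_boundP (normr_ge0 M)) _.
  by rewrite ltr_nat (leq_trans _ ln) // leq_maxr.
have n00 : 0 < n%:R :> R by rewrite ltr0n (leq_trans _ ln) // leq_max orbT.
have := hK _ Mn; rewrite f1 f2 -EFinD -EFinM lee_fin ler_pdivrMr // => h.
by rewrite /= ltNge h.
Qed.
End Gamma.

Section Tents.
Variable R : realType.
Let q : R := 1 + Num.sqrt 2.

Lemma silver_gt1 : 1 < q.
Proof. by rewrite ltrDl sqrtr_gt0. Qed.
Let q1 := silver_gt1.
Let q0 : 0 < q. Proof. exact: lt_trans ltr01 q1. Qed.
Lemma silver_sqr : q * q = 2 * q + 1.
Proof.
have s : Num.sqrt 2 * Num.sqrt 2 = 2 :> R by rewrite -expr2 sqr_sqrtr.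
by rewrite /q mulrDl !mulrDr s; ring.
Qed.

Lemma tent_index (x : R) : 1 <= x -> exists i, q ^+ i <= x /\ x < q ^+ i.+1.
Proof.
move=> x1.
have ex : exists n, x < q ^+ n.
  have grow n : 1 + n%:R * (q - 1) <= q ^+ n.
    elim: n => [|n IH]; first by rewrite mul0r addr0.
    rewrite exprS; apply: le_trans (_ : q * (1 + n%:R * (q - 1)) <= _); last by rewrite ler_pM2l.
    have : 0 <= n%:R * ((q - 1) * (q - 1)) by rewrite !mulr_ge0 // subr_ge0 ltW.
    by rewrite -natr1; lra.
  have [n n0 hn] := @archi_mulr R x (q - 1) (ltac:(by rewrite subr_gt0)).
  by exists n; apply: lt_le_trans (grow n); lra.
case: (ex_minnP ex) => -[|i] hi mi; first by rewrite expr0 ltNge x1 in hi.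
exists i; split=> //; rewrite leNgt; apply/negP => /mi; by rewrite ltnn.
Qed.

(** A tent with slopes 1 and -1 over the interval from q^i to q^(i+1), pointing down for odd
    i.  Its height is q^i (q - 1) / 2. *)
Definition tent (i : nat) (x : R) : R := (-1) ^+ i * Num.min (x - q ^+ i) (q ^+ i.+1 - x).
Definition tents (x : R) : R :=
  tent (xget 0%N [set i | q ^+ i <= x /\ x < q ^+ i.+1]%classic) x * (1 <= x)%R%:R.

Lemma leq_silver i j : (i <= j)%N -> q ^+ i <= q ^+ j.
Proof. by move=> ij; rewrite ler_eXn2l. Qed.

Lemma tentsE i x : q ^+ i <= x -> x < q ^+ i.+1 -> tents x = tent i x.
Proof.
move=> h1 h2; have x1 : 1 <= x by apply: le_trans h1; rewrite -[1](expr0 q) leq_silver.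
rewrite /tents x1 mulr1; congr tent; apply: xget_unique; first by [].
move=> j [h3 h4]; apply/eqP; rewrite eqn_leq; apply/andP; split; rewrite leqNgt; apply/negP => ij.
  by have := le_lt_trans (le_trans (leq_silver ij) h3) h2; rewrite ltxx.
by have := le_lt_trans (le_trans (leq_silver ij) h1) h4; rewrite ltxx.
Qed.

Lemma tents_small x : x < 1 -> tents x = 0.
Proof. by move=> x1; rewrite /tents leNgt x1 mulr0. Qed.

Lemma norm_tent i x : q ^+ i <= x -> x < q ^+ i.+1 ->
  `|tent i x| <= x - q ^+ i /\ `|tent i x| <= q ^+ i.+1 - x.
Proof.
move=> h1 h2; rewrite normrM normrX normrN1 expr1n mul1r ger0_norm.
  by rewrite !ge_min !lexx orbT.
by rewrite le_min !subr_ge0 h1 ltW.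
Qed.

Lemma tents_nonexpansive_le x y : x <= y -> `|tents x - tents y| <= y - x.
Proof.
move=> xy; have [y1|y1] := ltP y 1.
  by rewrite !tents_small ?(le_lt_trans xy) // subrr normr0 subr_ge0.
have [j [j1 j2]] := tent_index y1; have [n1 n2] := norm_tent j1 j2.
have [x1|x1] := ltP x 1.
  rewrite tents_small // sub0r normrN (tentsE j1 j2).
  have : 1 <= q ^+ j by rewrite -[1](expr0 q) leq_silver.
  lra.
have [i [i1 i2]] := tent_index x1; have [n3 n4] := norm_tent i1 i2.
rewrite (tentsE i1 i2) (tentsE j1 j2).
case: (ltngtP i j) => ij.
- have := leq_silver ij; have := ler_normB (tent i x) (tent j y); lra.
- by have := leq_silver ij; lra.
- rewrite -ij /tent -mulrBr normrM normrX normrN1 expr1n mul1r.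
  by rewrite ler_norml; apply/andP; split; case: (leP (x - _)); case: (leP (y - _)); lra.
Qed.

(** Let i be such that t lies between the heights of the tents i and i + 1.  Then height t is
    reached in one direction at q^(i+1) + t, and in the other at q^(i+2) + t.  As
    q^i (q - 1) <= 2 t, the sum of these times is at most
    2 t (1 + q (q + 1) / (q - 1)) = (8 + 4 sqrt 2) t. *)
Lemma tents_reach t : q - 1 <= 2 * t ->
  exists x y, [/\ 0 <= x, 0 <= y, t <= tents x, t <= - tents y &
     x + y <= (8 + 4 * Num.sqrt 2) * t].
Proof.
move=> qt.
have q10 : 0 < q - 1 by rewrite subr_gt0.
have [|i [i1 i2]] := @tent_index (2 * t / (q - 1)); first by rewrite ler_pdivlMr // mul1r.
rewrite ler_pdivlMr // in i1; rewrite exprS ltr_pdivrMr // in i2.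
have E1 : q ^+ i.+1 = q * q ^+ i by rewrite exprS.
have E2 : q ^+ i.+2 = (2 * q + 1) * q ^+ i by rewrite !exprS mulrA silver_sqr.
have E3 : q ^+ i.+3 = (5 * q + 2) * q ^+ i.
  by rewrite exprS E2 mulrA mulrDr mulr1 mulrCA silver_sqr; ring.
have A0 : 0 < q ^+ i by rewrite exprn_gt0.
have qA0 : 0 < q * q ^+ i by rewrite mulr_gt0.
have t0 : 0 < t by lra.
have i2' : 2 * t < q * q ^+ i + q ^+ i.
  have -> : q * q ^+ i + q ^+ i = q * q ^+ i * (q - 1).
    by rewrite mulrBr mulr1 mulrAC silver_sqr; ring.
  by [].
pose x1 := q ^+ i.+1 + t; pose x2 := q ^+ i.+2 + t.
have T1 : tents x1 = (-1) ^+ i.+1 * t.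
  rewrite (@tentsE i.+1) ?/x1 ?lerDl ?(ltW t0) //; last by rewrite E1 E2; lra.
  rewrite /tent addrAC subrr add0r min_l // E1 E2; lra.
have T2 : tents x2 = (-1) ^+ i.+2 * t.
  rewrite (@tentsE i.+2) ?/x2 ?lerDl ?(ltW t0) //; last by rewrite E2 E3; lra.
  rewrite /tent addrAC subrr add0r min_l // E2 E3; lra.
have sum : x1 + x2 <= (8 + 4 * Num.sqrt 2) * t.
  have r0 : 0 < Num.sqrt 2 :> R by rewrite sqrtr_gt0.
  have rr : Num.sqrt 2 * Num.sqrt 2 = 2 :> R by rewrite -expr2 sqr_sqrtr.
  have qE : q = 1 + Num.sqrt 2 by [].
  have Ar : q ^+ i <= Num.sqrt 2 * t.
    rewrite -(ler_pM2r r0); have -> : Num.sqrt 2 * t * Num.sqrt 2 = 2 * t by rewrite mulrAC rr.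
    by move: i1; rewrite (_ : q - 1 = Num.sqrt 2) // /q addrAC subrr add0r.
  have B2 : Num.sqrt 2 * q ^+ i <= 2 * t.
    by rewrite (_ : 2 * t = Num.sqrt 2 * (Num.sqrt 2 * t)) ?ler_pM2l // mulrA rr.
  have qq : q * q ^+ i = q ^+ i + Num.sqrt 2 * q ^+ i by rewrite {1}qE mulrDl mul1r.
  rewrite /x1 /x2 E1 E2 (mulrDl (2 * q)) mul1r -(mulrA 2) qq.
  by move: (q ^+ i) Ar B2 => A; lra.
have x10 : 0 <= x1 by rewrite addr_ge0 ?exprn_ge0 // ltW.
have x20 : 0 <= x2 by rewrite addr_ge0 ?exprn_ge0 // ltW.
have s1 : (-1) ^+ i.+1 = - (-1) ^+ i :> R by rewrite exprS mulN1r.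
have s2 : (-1) ^+ i.+2 = (-1) ^+ i :> R by rewrite !exprS mulrA mulrNN !mul1r.
have s0 : (-1) ^+ i = if odd i then -1 else 1 :> R by rewrite -signr_odd; case: (odd i).
rewrite s1 s0 in T1; rewrite s2 s0 in T2; case: (odd i) in T1 T2.
  by exists x1, x2; rewrite T1 T2 opprK mulN1r opprK mul1r.
by exists x2, x1; rewrite T1 T2 mulN1r opprK mul1r; split=> //; rewrite addrC.
Qed.
End Tents.

Section SilverValue.
Local Open Scope classical_set_scope.
Variable R : realType.

Lemma tents_nonexpansive : nonexpansive (@tents R).
Proof.
move=> x y _ _; case: (leP x y) => xy.
  by rewrite [X in _ <= X]distrC [X in _ <= X]ger0_norm ?subr_ge0 // tents_nonexpansive_le.
by rewrite distrC [X in _ <= X]gtr0_norm ?subr_gt0 // tents_nonexpansive_le // ltW.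
Qed.

Lemma h_at_0 : h (0 : R) = (8 + 4 * Num.sqrt 2)%:E.
Proof.
apply/eqP; rewrite eq_le; apply/andP; split; last first.
  apply: le_ereal_inf_tmp => _ [g [g0 lg] <-].
  by apply: limsup_first_reach => //; exact: lipschitz_nonexpansive.
apply: ge_ereal_inf; exists (limf_esup (fun t : R =>
  (Gamma_plus 0 (@tents R) t + Gamma_minus 0 (@tents R) t) * t^-1%:E)%E (pinfty_nbhs R)).
  exists (@tents R) => //; split; first by rewrite tents_small.
  move=> [x y] [/= x0 y0]; rewrite mul1r; apply: tents_nonexpansive.
    by move: x0; rewrite in_itv /= andbT.
  by move: y0; rewrite in_itv /= andbT.
pose V := [set t : R | Num.sqrt 2 < t].
apply: ge_ereal_inf; eexists.
  by exists V; [exists (Num.sqrt 2); split=> //; exact: ger0_real (sqrtr_ge0 _)|].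
apply: ge_ereal_sup => _ [t Vt <-].
have t0 : 0 < t by apply: le_lt_trans Vt; exact: sqrtr_ge0.
have [|x [y [x0 y0 tx ty xy]]] := @tents_reach R t.
  by rewrite addrAC subrr add0r; have : Num.sqrt 2 < t by []; lra.
rewrite Gamma_plus0 Gamma_minus0.
have h1 : (first_reach (@tents R) t <= x%:E)%E by apply: first_reach_le => //; exact: tents_nonexpansive.
have h2 : (first_reach (fun x => - @tents R x)%R t <= y%:E)%E.
  by apply: first_reach_le => //; apply: nonexpansiveN; exact: tents_nonexpansive.
apply: le_trans (_ : ((x + y)%:E * t^-1%:E <= _)%E); last first.
  by rewrite -EFinM lee_fin ler_pdivrMr.
by rewrite lee_pmul2r ?lte_fin ?invr_gt0 // EFinD leeD.
Qed.

Lemma f_at_1 : f (1%:E : \bar R) = 1 - (5 + 2 * Num.sqrt 2)^-1.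
Proof.
rewrite /f oner_eq0 subrr mul0r h_at_0 /=.
have s0 : 0 <= Num.sqrt 2 :> R by rewrite sqrtr_ge0.
congr (_ - _); rewrite div1r; congr (_^-1); by field.
Qed.

Lemma silver_ratio : 1 - (5 + 2 * Num.sqrt 2)^-1 = (12 + Num.sqrt 8) / 17 :> R.
Proof.
have s0 : 0 <= Num.sqrt 2 :> R by rewrite sqrtr_ge0.
have s22 : Num.sqrt 2 * Num.sqrt 2 = 2 :> R by rewrite -expr2 sqr_sqrtr.
have -> : Num.sqrt 8 = 2 * Num.sqrt 2 :> R.
  rewrite (_ : 8 = 2 ^+ 2 * 2); last by rewrite expr2; ring.
  by rewrite sqrtrM ?sqr_ge0 // sqrtr_sqr ger0_norm.
have n0 : 5 + 2 * Num.sqrt 2 != 0 :> R by rewrite gt_eqF //; lra.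
apply: (mulIf n0); rewrite mulrBl mul1r mulVf //.
have -> : (12 + 2 * Num.sqrt 2) / 17 * (5 + 2 * Num.sqrt 2) =
  (60 + 34 * Num.sqrt 2 + 4 * (Num.sqrt 2 * Num.sqrt 2)) / 17 :> R by field.
by rewrite s22; field.
Qed.
End SilverValue.

(** * The Ramsey upper density of grids *)

Section UpperDensity.
Local Open Scope classical_set_scope.
Variable R : realType.
Implicit Types (S : set nat) (lam : R).

Lemma upper_density_ge S lam :
  (forall j, exists2 n, (j <= n)%N & lam * n%:R <= (count (fun k => k \in S) (iota 1 n))%:R) ->
  (lam%:E <= upper_density R S)%E.
Proof.
move=> often; apply: le_ereal_inf_tmp => _ [V [j _ jV] <-].
have [n jn hn] := often (maxn j 1).
have n0 : 0 < n%:R :> R by rewrite ltr0n (leq_trans _ jn) // leq_maxr.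
apply: le_trans (_ : ((count (fun k => k \in S) (iota 1 n))%:R / n%:R)%:E <= _)%E.
  by rewrite lee_fin ler_pdivlMr.
apply: ereal_sup_ubound; exists n => //; apply: jV.
by rewrite /= (leq_trans _ jn) // leq_maxl.
Qed.

(** The constant C disappears in the limit. *)
Lemma upper_density_le S lam (C : R) : 0 <= lam ->
  (forall n, (count (fun k => k \in S) (iota 1 n))%:R <= lam * n%:R + C) ->
  (upper_density R S <= lam%:E)%E.
Proof.
move=> lam0 bnd; apply/lee_addgt0Pr => e e0.
have [j j0 hj] := archi_mulr C e0.
apply: ge_ereal_inf; eexists; first by exists [set n | (j <= n)%N]; [exists j|].
apply: ge_ereal_sup => _ [n /= jn <-].
have n0 : 0 < n%:R :> R by rewrite ltr0n (leq_trans j0).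
rewrite -EFinD lee_fin ler_pdivrMr //; apply: le_trans (bnd n) _.
rewrite mulrDl lerD2l; apply: (le_trans hj).
by rewrite ler_pM2l // ler_nat.
Qed.
End UpperDensity.

Section Copies.
Local Open Scope classical_set_scope.
Variables (T : Type) (H : graph T) (phi : T -> nat).
Hypothesis phi_inj : injective phi.

(** phi takes values in the numbers from 0, while the vertices of K_N start at 1. *)
Definition copy_graph : graph nat.
Proof.
refine (@Graph nat [set n | exists2 x, vertices H x & n = (phi x).+1]
  (fun m n => exists x y, [/\ adj H x y, m = (phi x).+1 & n = (phi y).+1]) _ _ _).
- by move=> m n [x [y [xy -> _]]]; exists x => //; exact: adj_vertices xy.
- by move=> m n [x [y [xy -> ->]]]; exists y, x; split=> //; exact: adj_sym.
- move=> n [x [y [xy -> []]]] /phi_inj xE; rewrite -xE in xy; exact: (adj_irrefl xy).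
Defined.

Lemma copy_graph_sub : subgraph copy_graph K_N.
Proof.
split; first by move=> n [x _ ->].
move=> _ _ [x [y [xy -> ->]]]; split=> // -[/phi_inj xE].
by rewrite -xE in xy; exact: (adj_irrefl xy).
Qed.

Lemma copy_graph_iso (x0 : T) : isomorphic copy_graph H.
Proof.
have /choice[psi psiE] : forall n, exists x,
    (exists2 y, vertices H y & n = (phi y).+1) -> vertices H x /\ n = (phi x).+1.
  move=> n; case: (pselect (exists2 y, vertices H y & n = (phi y).+1)) => [[y Hy ->]|no].
    by exists y.
  by exists x0 => /no.
have psiK x : vertices H x -> psi (phi x).+1 = x.
  move=> Hx; have [|_ [/phi_inj //]] := psiE (phi x).+1; by exists x.
exists psi.
- split.
  + by move=> _ [x Hx ->] /=; rewrite psiK.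
  + by move=> m n; rewrite !in_setE => -[x Hx ->] [y Hy ->]; rewrite !psiK // => ->.
  + by move=> x Hx; exists (phi x).+1; [exists x|rewrite psiK].
- move=> _ _ [x Hx ->] [y Hy ->]; rewrite !psiK //; split=> [|xy]; last by exists x, y.
  by move=> [x' [y' [xy [/phi_inj -> ] [/phi_inj ->]]]].
Qed.
End Copies.

Section Grids.
Variables (R : realType) (d : nat) (d_gt0 : (0 < d)%N).

(** Strict inequality suffices, since the Ramsey upper density is a supremum. *)
Lemma grid_lower_bound (lam : R) : 0 < lam -> lam < 1 - (5 + 2 * Num.sqrt 2)^-1 ->
  (lam%:E <= ramsey_upper_density R (grid R d))%E.
Proof.
move=> lam0 lam1; apply: ereal_sup_ubound; exists lam => // c c_sym.
have [phi [kappa [phi_inj phi_col phi_dense]]] :=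
  @dense_copy R 'rV[int]_d (@grid_nb d) (@parity d) (@parity_nb d) (@grid_nb_sym d)
    (fun eta => @grid_patches R d eta d_gt0) (fun v w => c v.+1 w.+1) lam
    (fun v w => c_sym v.+1 w.+1) lam0 lam1.
exists (copy_graph (grid R d) phi_inj); split.
- exact: copy_graph_sub.
- exact: copy_graph_iso 0.
- by exists kappa => _ _ [x [y [/adj_gridP xy -> ->]]]; exact: phi_col.
apply: upper_density_ge => j; have [n jn hn] := phi_dense j; exists n => //.
apply: (le_trans hn); rewrite ler_nat (iotaDl 1 0 n) count_map.
apply: sub_count => v /asboolP[x xv] /=; rewrite in_setE.
by exists x; rewrite // xv.
Qed.

(** The error is multiplied by 1 - sqrt 2 at each step. *)
Lemma pell_silver n : `|(pell n.+1)%:R - (1 + Num.sqrt 2) * (pell n)%:R| <= 1 :> R.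
Proof.
have s0 : 0 < Num.sqrt 2 :> R by rewrite sqrtr_gt0.
have s22 : Num.sqrt 2 * Num.sqrt 2 = 2 :> R by rewrite -expr2 sqr_sqrtr.
have s2 : Num.sqrt 2 <= 2 :> R.
  rewrite leNgt; apply/negP => h.
  by have : 2 * 2 < Num.sqrt 2 * Num.sqrt 2 :> R by [apply: ltr_pM]; rewrite s22; lra.
have s1 : 1 <= Num.sqrt 2 :> R by rewrite -[X in X <= _]sqrtr1 ler_wsqrtr // ler1n.
elim: n => [|n IH]; first by rewrite mulr0 subr0 normr1.
have -> : (pell n.+2)%:R - (1 + Num.sqrt 2) * (pell n.+1)%:R =
   (1 - Num.sqrt 2) * ((pell n.+1)%:R - (1 + Num.sqrt 2) * (pell n)%:R) :> R.
  rewrite pellSS natrD natrM; move: (pell n.+1)%:R (pell n)%:R => u v.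
  have -> : (1 - Num.sqrt 2) * (u - (1 + Num.sqrt 2) * v) =
    u - Num.sqrt 2 * u - v + (Num.sqrt 2 * Num.sqrt 2) * v by ring.
  by rewrite s22; ring.
rewrite normrM; apply: le_trans (_ : 1 * 1 <= _); last by rewrite mulr1.
apply: ler_pM => //; rewrite ler_norml; apply/andP; split; lra.
Qed.

(** At least pell i + j vertices are missing among the first n, where
    n <= 2 pell (i + 1) + 3 pell i + 2 j.  As pell (i + 1) is (1 + sqrt 2) pell i up to 1,
    this is at most (5 + 2 sqrt 2) (pell i + j) + 2. *)
Lemma grid_upper_bound : (ramsey_upper_density R (grid R d) <= (1 - (5 + 2 * Num.sqrt 2)^-1)%:E)%E.
Proof.
have s0 : 0 <= Num.sqrt 2 :> R by rewrite sqrtr_ge0.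
apply: ge_ereal_sup => _ [l hl <-].
have [H' [sub [psi psi_bij psi_adj] [b mono] lH]] := hl _ key_colourC.
apply: (le_trans lH); pose x0 : R := 5 + 2 * Num.sqrt 2.
have x00 : 0 < x0 by rewrite /x0; lra.
apply: (@upper_density_le _ _ _ 1).
  by rewrite subr_ge0 invf_le1 //; rewrite /x0; lra.
move=> n.
pose i0 := Ordinal d_gt0.
(* g is the translation by a basis vector, seen inside the copy. *)
have /choice[g hg] : forall v, exists w, vertices H' v.+1 ->
    [/\ vertices H' w.+1, adj H' v.+1 w.+1 & psi w.+1 = psi v.+1 + unit_step i0 false].
  move=> v; case: (pselect (vertices H' v.+1)) => [Hv|]; last by exists 0%N.
  have [_ _ /(_ (psi v.+1 + unit_step i0 false) I)[w Hw wE]] := psi_bij.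
  have wpos : (0 < w)%N by have := proj1 sub w Hw.
  exists w.-1; rewrite prednK // => _; split=> //.
  apply/(psi_adj _ _ Hv Hw); rewrite wE; apply/adj_gridP/grid_nbP.
  by exists i0, false.
have [i [j [nB miss]]] := missing_vertices n.
have := miss (fun v => v.+1 \in vertices H') b g.
have -> : count (fun v => v.+1 \in vertices H') (iota 0 n) =
    count (fun k => k \in vertices H') (iota 1 n).
  by rewrite (iotaDl 1 0 n) count_map.
have inV v : v.+1 \in vertices H' -> vertices H' v.+1 by rewrite in_setE.
have [_ psi_inj _] := psi_bij.
move=> h0.
have {h0} h : (count (fun k => k \in vertices H') (iota 1 n) + (pell i + j) <= n)%N.
  apply: h0.
- move=> v w; rewrite !unfold_in => /inV Hv /inV Hw gvw.
  have [_ _ gv] := hg v Hv; have [_ _ gw] := hg w Hw.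
  rewrite gvw gw in gv; have /addIr vw := gv.
  by have [] := psi_inj _ _ (mem_set Hw) (mem_set Hv) vw.
- move=> v /inV Hv; have [_ adjv _] := hg v Hv.
  exact: mono _ _ adjv.
have pb := pell_silver i; rewrite ler_norml in pb; case/andP: pb => _ pb.
have h1 : (count (fun k => k \in vertices H') (iota 1 n))%:R + ((pell i)%:R + j%:R) <= n%:R :> R.
  by rewrite -!natrD ler_nat.
have h2 : n%:R <= 2 * (pell i.+1)%:R + 3 * (pell i)%:R + 2 * j%:R :> R.
  by rewrite -!natrM -!natrD ler_nat.
have h3 : n%:R <= x0 * ((pell i)%:R + j%:R) + 2.
  have : 0 <= Num.sqrt 2 * j%:R :> R by rewrite mulr_ge0.
  have : 0 <= j%:R :> R by [].
  by rewrite /x0; lra.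
have h4 : n%:R / x0 <= (pell i)%:R + j%:R + 1.
  by rewrite ler_pdivrMr // mulrC; rewrite /x0 in h3 *; lra.
by rewrite mulrBl mul1r [_^-1 * _]mulrC; lra.
Qed.

End Grids.

Theorem corollary6 (R : realType) (d : nat) (d_gt0 : (0 < d)%N) :
  ramsey_upper_density R (grid R d) = (f (1%:E : \bar R))%:E /\
  f (1%:E : \bar R) = (12 + Num.sqrt 8) / 17.
Proof.
split; last by rewrite f_at_1 silver_ratio.
rewrite f_at_1; apply/eqP; rewrite eq_le grid_upper_bound //=.
have s0 : 0 <= Num.sqrt 2 :> R by rewrite sqrtr_ge0.
set rho := 1 - _; have rho0 : 0 < rho.
  by rewrite subr_gt0 invf_lt1; lra.
apply/lee_subgt0Pr => e e0.
pose lam := Num.max (rho - e) (rho / 2).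
apply: le_trans (_ : (lam%:E <= _)%E).
  by rewrite -EFinB lee_fin le_max lexx.
apply: grid_lower_bound => //; first by rewrite lt_max divr_gt0 // orbT.
by rewrite -/rho gt_max; apply/andP; split; lra.
Qed.
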